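(* Let $\mu>\sqrt2$ be fixed and $\delta>0$, and let $h,h^\delta\in L^2(\Omega)$, $f,f^\delta\in L^\infty(0,\tau;L^2(\Omega))$ satisfy $\|h-h^\delta\|^2+\theta\|f-f^\delta\|^2_{L^\infty(0,\tau;L^2(\Omega))}\le\delta^2$. Assume that there is $N\in\mathbb N$ with $$\|\Upsilon_{h^\delta,f^\delta}-\Upsilon^N_{h^\delta,f^\delta}\|\le\mu\delta<\|\Upsilon_{h^\delta,f^\delta}-\Upsilon^{N-1}_{h^\delta,f^\delta}\|$$ (as is the case for $\delta$ sufficiently small), and let $N_\delta$ be the smallest such $N$. Let $g\in L^2(\Omega)$ be the solution of $Tg=\Upsilon_{h,f}$. If $g\in S_{\varrho,p}$ for some $\varrho,p>0$, then there is a constant $C_{23}>0$, depending only on $\mu,\alpha,\tau,\lambda_1,e_1,e_2,p$, such that $$\|g-g^{\delta,N_\delta}\|\le C_{23}\,\varrho^{2/(p+2)}\delta^{p/(p+2)}.$$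
   Context: Setting: $d\in\{1,\dots,7\}$, $\Omega\subset\mathbb R^d$ is a bounded domain with sufficiently smooth boundary, $\tau>0$, $\alpha\in(0,1)$, $\mathbb N=\{1,2,\dots\}$; $\|\cdot\|$ and $\langle\cdot,\cdot\rangle$ are the norm and inner product of $L^2(\Omega)$. $0<\lambda_1<\lambda_2\le\cdots\to\infty$ are the Dirichlet eigenvalues of $-\Delta$ on $\Omega$ with eigenfunctions $\varphi_n\in H_0^1(\Omega)\cap H^2(\Omega)$ forming an orthonormal basis of $L^2(\Omega)$; $e_1,e_2>0$ are constants with $e_1n^{2/d}\le\lambda_n\le e_2n^{2/d}$ for all $n\in\mathbb N$ (known to exist). $w_n=\langle w,\varphi_n\rangle$ for $w\in L^2(\Omega)$, and $z_n(s)=\langle z(s),\varphi_n\rangle$ for $z\in L^\infty(0,\tau;L^2(\Omega))$. $\theta=\sum_{n=1}^\infty\lambda_n^{-4}<\infty$. Mittag-Leffler function: $E_{\gamma,b}(z)=\sum_{k=0}^\infty z^k/\Gamma(k\gamma+b)$. It is known that there are constants $C_1,C_2>0$, depending only on $\alpha$, with $\frac{C_1}{\Gamma(1-\alpha)}\frac1{1-x}\le E_{\alpha,1}(x)\le\frac{C_2}{\Gamma(1-\alpha)}\frac1{1-x}$ for all $x\le0$. For $h\in L^2(\Omega)$, $f\in L^\infty(0,\tau;L^2(\Omega))$: $\Psi_f^{\alpha,n}(t)=\int_0^t(t-s)^{\alpha-1}E_{\alpha,\alpha}(-\lambda_n^2(t-s)^\alpha)f_n(s)\,ds$, $\Upsilon_{h,f}^{\alpha,n}=h_n-\Psi_f^{\alpha,n}(\tau)$,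 $\Upsilon_{h,f}=\sum_{n=1}^\infty\Upsilon_{h,f}^{\alpha,n}\varphi_n\in L^2(\Omega)$, $\Upsilon^N_{h,f}=\sum_{n=1}^N\Upsilon_{h,f}^{\alpha,n}\varphi_n$, $\Upsilon^0_{h,f}=0$ (and similarly for $h^\delta,f^\delta$). The operator $T:L^2(\Omega)\to L^2(\Omega)$ is $T\phi=\sum_nE_{\alpha,1}(-\lambda_n^2\tau^\alpha)\langle\phi,\varphi_n\rangle\varphi_n$. Source set: $S_{\varrho,p}=\{\phi\in L^2(\Omega):\|\phi\|_{H_p}\le\varrho\}$, $\|\phi\|_{H_p}^2=\sum_n\lambda_n^{2p}|\langle\phi,\varphi_n\rangle|^2$. Fourier truncation regularized solution: $g^{\delta,N}=\sum_{n=1}^N\frac{\Upsilon_{h^\delta,f^\delta}^{\alpha,n}}{E_{\alpha,1}(-\lambda_n^2\tau^\alpha)}\varphi_n$ for $N\in\mathbb N$. *)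

(* Defs.v *)
From HB Require Import structures.
From mathcomp Require Import all_boot all_order all_algebra.
From mathcomp Require Import all_classical all_reals all_analysis.

Set Implicit Arguments.
Unset Strict Implicit.
Unset Printing Implicit Defensive.

Import Order.TTheory GRing.Theory Num.Theory.
Import numFieldNormedType.Exports.

Local Open Scope classical_set_scope.
Local Open Scope ring_scope.

Definition measure_rV_display : measure_display -> measure_display.
Proof. exact. Qed.

Section measurable_rV.
Context {R : realType}.
Variable n : nat.

Let coors : 'I_n -> 'rV[R]_n -> R := fun i v => v ord0 i.

Let rV_set0 : g_sigma_preimage coors set0.
Proof. exact: sigma_algebra0. Qed.

Let rV_setC A : g_sigma_preimage coors A -> g_sigma_preimage coors (~` A).
Proof. exact: sigma_algebraC. Qed.

Let rV_bigcup (F : _^nat) : (forall i, g_sigma_preimage coors (F i)) ->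
  g_sigma_preimage coors (\bigcup_i (F i)).
Proof. exact: sigma_algebra_bigcup. Qed.

HB.instance Definition _ := @isMeasurable.Build
  (measure_rV_display (R.-ocitv.-measurable).-sigma)
  ('rV[R]_n) (g_sigma_preimage coors) rV_set0 rV_setC rV_bigcup.

Lemma measurable_rV_coord (i : 'I_n) :
  measurable_fun [set: 'rV[R]_n] (fun v => v ord0 i).
Proof.
move=> _ Y mY; rewrite setTI; apply: sub_sigma_algebra => /=.
rewrite -bigcup_seq/=; exists i => /=; first by rewrite mem_index_enum.
by exists Y => //; rewrite setTI.
Qed.

End measurable_rV.

Lemma measurable_fun_rVP {d0} {T : measurableType d0} {R : realType} n
    (f : T -> 'rV[R]_n) :
  (forall i, measurable_fun [set: T] (fun x => f x ord0 i : R)) ->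
  measurable_fun [set: T] f.
Proof.
move=> mf; pose G := [set A | measurable (f @^-1` A)].
suff : (@measurable _ 'rV[R]_n) `<=` G.
  by move=> h _ A mA; rewrite setTI; exact: h.
apply: smallest_sub.
  split=> [|A GA|F GF]; rewrite /G/=.
  - by rewrite preimage_set0; exact: measurable0.
  - by rewrite setTD preimage_setC; exact: measurableC.
  - by rewrite preimage_bigcup; apply: bigcup_measurable => k _; exact: GF.
rewrite -bigcup_seq => A [i _ [B mB <-]].
rewrite /G/= setTI; have := mf i measurableT B mB; rewrite setTI; exact.
Qed.

Lemma measurable_rV_box {R : realType} n (I : 'I_n -> interval R) :
  measurable [set v : 'rV[R]_n | forall i, v ord0 i \in I i].
Proof.
rewrite (_ : mkset _ =
    \bigcap_i ((fun v : 'rV[R]_n => v ord0 i) @^-1` [set` I i])).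
  apply: fin_bigcap_measurable => // i _.
  by rewrite -[X in measurable X]setTI; exact: measurable_rV_coord.
by apply/seteqP; split => [v h i _|v h i]; [exact: h|exact: (h i)].
Qed.

Lemma open_measurable_rV {R : realType} n (A : set 'rV[R]_n) :
  open A -> measurable A.
Proof.
move=> oA; pose c (q : 'rV[rat]_n) : 'rV[R]_n := map_mx (@ratr R) q.
have ballE q (r : R) : 0 < r -> ball (c q) r =
    [set v : 'rV[R]_n | forall i, v ord0 i \in `](c q ord0 i - r), (c q ord0 i + r)[].
  move=> r0; apply/seteqP; split => v /=.
    by move=> [_ h] i; have := h ord0 i; rewrite ball_itv /=.
  by move=> h; split=> // i j; rewrite ord1 ball_itv /=; exact: h.
pose F (qk : 'rV[rat]_n * nat) :=
  if `[< ball (c qk.1) qk.2.+1%:R^-1 `<=` A >]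
  then ball (c qk.1) qk.2.+1%:R^-1 else set0.
have -> : A = \bigcup_qk F qk.
  apply/seteqP; split => [v Av|v [qk _]]; rewrite /F; last first.
    by case: asboolP => [h|_ //]; exact: h.
  have /nbhs_ballP[e /= e0 eA] : nbhs v A by exact: open_nbhs_nbhs.
  pose k := Num.truncn (2 / e).
  have ke : k.+1%:R^-1 < e / 2.
    rewrite -[e / 2]invf_div ltf_pV2 ?posrE ?divr_gt0//; exact: truncnS_gt.
  have /choice[q qP] : forall j, exists q : rat,
      ball (v ord0 j) k.+1%:R^-1 (ratr q : R).
    move=> j; have [] := @dense_rat R (ball (v ord0 j) k.+1%:R^-1).
    - by exists (v ord0 j); apply: ballxx; rewrite invr_gt0.
    - exact: ball_open.
    by move=> x [h [q _ qx]]; exists q; rewrite qx.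
  exists (\row_j q j, k) => //=; case: asboolP => [_|[]].
    split; first by rewrite invr_gt0.
    by move=> i j; rewrite ord1 !mxE; exact/ball_sym/qP.
  move=> w [_ h]; apply: eA; split => // i j.
  have := h i j; rewrite !mxE ord1 => /(ball_triangle (qP j)).
  by apply: le_ball; rewrite [leRHS]splitr lerD// ltW.
apply: countable_bigcupT_measurable => [|qk]; first exact: countableP.
rewrite /F; case: asboolP => _; last exact: measurable0.
by rewrite ballE ?invr_gt0//; exact: measurable_rV_box.
Qed.

Section lebesgue_rV.
Context {R : realType}.

(* The identification of R x R^n with R^(n+1). *)
Definition rV_cons n (xv : R * 'rV[R]_n) : 'rV[R]_n.+1 :=
  row_mx (const_mx xv.1 : 'rV_1) xv.2.

Lemma rV_cons0 n xv : @rV_cons n xv ord0 ord0 = xv.1.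
Proof. by rewrite /rV_cons mxE; case: splitP => j //=; rewrite mxE. Qed.

Lemma rV_consS n xv (j : 'I_n) : @rV_cons n xv ord0 (lift ord0 j) = xv.2 ord0 j.
Proof.
rewrite /rV_cons mxE; case: splitP => k /=; first by rewrite ord1.
rewrite /bump /= !add1n => -[jk]; congr (xv.2 _ _); exact: val_inj.
Qed.

Lemma measurable_rV_cons n :
  measurable_fun [set: measurableTypeR R * 'rV[R]_n] (@rV_cons n).
Proof.
apply: measurable_fun_rVP => i; have [j ->|->] := unliftP ord0 i; last first.
  by under eq_fun do rewrite rV_cons0; exact: measurable_fst.
under eq_fun do rewrite rV_consS.
by apply: (measurableT_comp (measurable_rV_coord j)); exact: measurable_snd.
Qed.

Section step.
Variables (n : nat) (m : {sigma_finite_measure set 'rV[R]_n -> \bar R}).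

Definition lebesgue_rV_step : set 'rV[R]_n.+1 -> \bar R :=
  pushforward (lebesgue_measure \x m)%E (@rV_cons n).

Let pm : {measure set 'rV[R]_n.+1 -> \bar R} :=
  measure_function_pushforward__canonical__measure_function_Measure
    (lebesgue_measure \x m)%E (@measurable_rV_cons n).

Let step0 : lebesgue_rV_step set0 = 0%E.
Proof. exact: (measure0 pm). Qed.

Let step_ge0 A : (0 <= lebesgue_rV_step A)%E.
Proof. exact: (measure_ge0 pm). Qed.

Let step_sigma_additive : semi_sigma_additive lebesgue_rV_step.
Proof. exact: (@measure_semi_sigma_additive _ _ _ pm). Qed.

HB.instance Definition _ := isMeasure.Build _ _ _ lebesgue_rV_step
  step0 step_ge0 step_sigma_additive.

Let rV_uncons (v : 'rV[R]_n.+1) : R * 'rV[R]_n :=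
  (v ord0 ord0, \row_j v ord0 (lift ord0 j)).

Let rV_consK : cancel (@rV_cons n) rV_uncons.
Proof.
move=> [x v]; rewrite /rV_uncons rV_cons0; congr pair.
by apply/rowP => j; rewrite mxE rV_consS.
Qed.

Let rV_unconsK : cancel rV_uncons (@rV_cons n).
Proof.
move=> v; apply/rowP => i; have [j ->|->] := unliftP ord0 i; last first.
  by rewrite rV_cons0.
by rewrite rV_consS mxE.
Qed.

Let measurable_rV_uncons :
  measurable_fun [set: 'rV[R]_n.+1]
    (rV_uncons : 'rV[R]_n.+1 -> measurableTypeR R * 'rV[R]_n).
Proof.
apply: measurable_fun_pair; first exact: measurable_rV_coord.
apply: measurable_fun_rVP => j; under eq_fun do rewrite mxE.
exact: measurable_rV_coord.
Qed.

Let step_sigma_finite : sigma_finite setT lebesgue_rV_step.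
Proof.
have /sigma_finiteP[F [TF ndF Foo]] := sigma_finiteT (@lebesgue_measure R).
have /sigma_finiteP[G [TG ndG Goo]] := sigma_finiteT m.
exists (fun k => rV_uncons @^-1` (F k `*` G k)).
  apply/esym; rewrite -subTset => v _.
  have [i _ Fi] : (\bigcup_i F i) (rV_uncons v).1 by rewrite -TF.
  have [j _ Gj] : (\bigcup_j G j) (rV_uncons v).2 by rewrite -TG.
  exists (maxn i j) => //; split => /=.
    by move: Fi; exact/subsetPset/ndF/leq_maxl.
  by move: Gj; exact/subsetPset/ndG/leq_maxr.
move=> k; have [mF Fk] := Foo k; have [mG Gk] := Goo k; split.
  rewrite -[X in measurable X]setTI; apply: measurable_rV_uncons => //.
  exact: measurableX.
rewrite /lebesgue_rV_step /pushforward -comp_preimage.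
rewrite (_ : _ \o _ = id); last by apply/funext => xv; exact: rV_consK.
by rewrite product_measure1E// lte_mul_pinfty// ge0_fin_numE.
Qed.

HB.instance Definition _ := Measure_isSigmaFinite.Build _ _ _ lebesgue_rV_step
  step_sigma_finite.

End step.

Section base.

Let dirac_sigma_finite :
  sigma_finite setT (dirac (0 : 'rV[R]_0) : set 'rV[R]_0 -> \bar R).
Proof.
exists (fun=> setT); first by rewrite bigcup_const//; exists 0%N.
by move=> _; split => //; rewrite /dirac indicE in_setT ltry.
Qed.

HB.instance Definition _ := Measure_isSigmaFinite.Build _ _ _
  (dirac (0 : 'rV[R]_0) : set 'rV[R]_0 -> \bar R) dirac_sigma_finite.

Definition lebesgue_rV0 : {sigma_finite_measure set 'rV[R]_0 -> \bar R} :=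
  dirac (0 : 'rV[R]_0).

End base.

(* R^0 is a point and R^(n+1) = R x R^n. *)
Fixpoint lebesgue_rV n : {sigma_finite_measure set 'rV[R]_n -> \bar R} :=
  match n with
  | 0 => lebesgue_rV0
  | n'.+1 => lebesgue_rV_step (lebesgue_rV n')
  end.

(* Sanity check: a box has the product of its side lengths as measure. *)
Lemma lebesgue_rV_box n (a b : 'rV[R]_n) :
  (forall i, a ord0 i <= b ord0 i) ->
  lebesgue_rV n [set v : 'rV[R]_n | forall i, v ord0 i \in `]a ord0 i, b ord0 i]] =
  (\prod_(i < n) (b ord0 i - a ord0 i))%:E.
Proof.
elim: n a b => [|n IH] a b ab.
  rewrite big_ord0 /= /dirac indicE mem_set // => -[].
  by case.
rewrite big_ord_recl; set B := mkset _.
rewrite [LHS](_ : _ = (lebesgue_measure \x lebesgue_rV n)%E (@rV_cons n @^-1` B)) //.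
pose a' := \row_(j < n) a ord0 (lift ord0 j).
pose b' := \row_(j < n) b ord0 (lift ord0 j).
have -> : @rV_cons n @^-1` B = ([set` `]a ord0 ord0, b ord0 ord0]] `*`
  [set v : 'rV[R]_n | forall i, v ord0 i \in `]a' ord0 i, b' ord0 i]]).
  apply/seteqP; split => [[x v]/= h|[x v]/= [hx hv] i].
    split; first by have := h ord0; rewrite rV_cons0.
    by move=> j; have := h (lift ord0 j); rewrite rV_consS !mxE.
  have [j ->|->] := unliftP ord0 i; last by rewrite rV_cons0.
  by have := hv j; rewrite rV_consS !mxE.
rewrite product_measure1E //; last first.
  by apply: (measurable_rV_box (fun i => `]a' ord0 i, b' ord0 i]%R)).
rewrite IH => [|i]; last by rewrite !mxE.
rewrite EFinM; congr (_ * _)%E; last first.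
  by congr EFin; apply: eq_bigr => i _; rewrite !mxE.
transitivity (lebesgue_measure [set` `]a ord0 ord0, b ord0 ord0]%R]) => //.
rewrite lebesgue_measure_itv /= lte_fin; case: ltP => // ba; congr EFin.
by apply/esym/eqP; rewrite subr_eq0 eq_le ba ab.
Qed.

End lebesgue_rV.

Section calculus.
Context {R : realType} {d : nat}.
Implicit Types (f : 'rV[R]_d -> R) (U : set 'rV[R]_d).

Definition partial (i : 'I_d) f : 'rV[R]_d -> R := fun x => 'D_(delta_mx ord0 i) f x.

Definition partials (s : seq 'I_d) f := foldr partial f s.

Definition Ck_on (k : nat) U f := forall (s : seq 'I_d) x, U x ->
  ((size s <= k)%N -> {for x, continuous (partials s f)}) /\
  ((size s < k)%N -> forall i : 'I_d, derivable (partials s f) x (delta_mx ord0 i)).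

(* Near each boundary point, U is a sublevel set of a C^k function with
   nonvanishing gradient. *)
Definition Ck_boundary (k : nat) U := forall x, closure U x -> ~ U x ->
  exists (V : set 'rV[R]_d) (rho : 'rV[R]_d -> R),
    [/\ open V, V x, Ck_on k V rho,
        forall y, V y -> exists i, partial i rho y != 0 &
        forall y, V y -> (U y <-> rho y < 0)].

Definition test_function U f :=
  [/\ forall k, Ck_on k setT f,
      compact (closure [set x | f x != 0]) &
      closure [set x | f x != 0] `<=` U].

End calculus.

(* A boundary of class C^2 is the reading of "sufficiently smooth": it is what
   H^2-regularity of the Dirichlet eigenfunctions calls for. *)
Record smooth_domain (R : realType) (d : nat) := SmoothDomain {
  dom :> set 'rV[R]_d ;
  dom_nonempty : dom !=set0 ;
  dom_open : open dom ;
  dom_connected : connected dom ;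
  dom_bounded : bounded_set dom ;
  dom_boundary : Ck_boundary 2 dom }.

Section L2.
Context {R : realType} {d : nat}.
Variable Om : smooth_domain R d.

Definition dom_measure : {measure set 'rV[R]_d -> \bar R} :=
  mrestr (lebesgue_rV d) (open_measurable_rV (@dom_open _ _ Om)).

(* Elements are functions on R^d, of which only the values on Omega matter;
   as usual they are meant up to equality almost everywhere on Omega. *)
Definition L2 := LfunType dom_measure (lee1n 2 : (1 <= 2%:E)%E).

Definition L2norm (u : L2) : R := fine ('N[dom_measure]_2%:E[EFin \o u])%E.

Definition L2inner (u v : L2) : R := \int[dom_measure]_x (u x * v x).

Definition L2_cvg (u : nat -> L2) (v : L2) := L2norm (u n - v) @[n --> \oo] --> 0.

(* The sum of a series converging in L^2(Omega), the default value 0 being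
   returned in case of divergence. *)
Definition L2_series (u : nat -> L2) : L2 :=
  xget 0 [set v | L2_cvg (fun N => \sum_(n < N) u n) v].

Definition L2_orthonormal_basis (phi : nat -> L2) :=
  (forall m n, L2inner (phi m) (phi n) = (m == n)%:R) /\
  (forall w, L2_cvg (fun N => \sum_(n < N) L2inner w (phi n) *: phi n) w).

Definition weak_partial (i : 'I_d) (u v : L2) :=
  forall psi, test_function Om psi ->
    \int[dom_measure]_x (u x * partial i psi x) =
    - \int[dom_measure]_x (v x * psi x).

(* H^1_0(Omega): the H^1-closure of the test functions. *)
Definition H10 (u : L2) :=
  exists (du : 'I_d -> L2) (psi : nat -> 'rV[R]_d -> R),
    [/\ forall i, weak_partial i u (du i),
        forall k, test_function Om (psi k),
        ('N[dom_measure]_2%:E[EFin \o (psi k \- u)%R])%E @[k --> \oo] --> 0%E &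
        forall i, ('N[dom_measure]_2%:E[EFin \o (partial i (psi k) \- du i)%R])%E
                    @[k --> \oo] --> 0%E].

(* u belongs to H^2(Omega), with weak Laplacian v. *)
Definition H2_laplacian (u v : L2) :=
  exists (du : 'I_d -> L2) (ddu : 'I_d -> 'I_d -> L2),
    [/\ forall i, weak_partial i u (du i),
        forall i j, weak_partial j (du i) (ddu i j) &
        v = \sum_(i < d) ddu i i %[ae dom_measure]].

(* lam n and phi n stand for lambda_(n+1) and phi_(n+1). *)
Definition dirichlet_eigensystem (lam : nat -> R) (phi : nat -> L2) :=
  [/\ 0 < lam 0%N, lam 0%N < lam 1%N,
      forall n, lam n <= lam n.+1,
      lam n @[n --> \oo] --> +oo &
      L2_orthonormal_basis phi /\
      forall n, H10 (phi n) /\ H2_laplacian (phi n) (- lam n *: phi n)].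

End L2.

Section mittag_leffler.
Context {R : realType}.

Definition Gamma (x : R) : R :=
  \int[lebesgue_measure]_(t in `]0, +oo[) (t `^ (x - 1) * expR (- t)).

Definition mittag_leffler (gamma b z : R) : R :=
  limn (series (fun k => z ^+ k / Gamma (k%:R * gamma + b))).

End mittag_leffler.

Section bochner.
Context {R : realType} {d : nat}.
Variables (Om : smooth_domain R d) (tau : R).

Definition time_measure : {measure set (measurableTypeR R) -> \bar R} :=
  mrestr lebesgue_measure (measurable_itv `]0, tau[).

(* Almost everywhere on ]0, tau[, a limit of simple functions. *)
Definition strongly_measurable (f : R -> L2 Om) :=
  exists (m : nat -> nat) (A : nat -> nat -> set (measurableTypeR R))
         (v : nat -> nat -> L2 Om),
    (forall k i, measurable (A k i)) /\
    {ae time_measure, forall s,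
      L2_cvg (fun k => \sum_(i < m k) (\1_(A k i) s : R) *: v k i) (f s)}.

Definition ess_norm (f : R -> L2 Om) : \bar R :=
  ('N[time_measure]_+oo[(fun s => (L2norm (f s))%:E)])%E.

Definition Linfty_L2 (f : R -> L2 Om) :=
  strongly_measurable f /\ (ess_norm f < +oo)%E.

Definition Linfty_norm (f : R -> L2 Om) : R := fine (ess_norm f).

End bochner.

Section problem.
Context {R : realType} {d : nat} {Om : smooth_domain R d}.
Variables (alpha tau : R) (lam : nat -> R) (phi : nat -> L2 Om).
Implicit Types (h g : L2 Om) (f : R -> L2 Om).

Definition theta : R := limn (series (fun n => (lam n ^+ 4)^-1)).

(* With 0-based modes: Psi f n is the function of the (n+1)-st eigenmode, and
   sums over n < N below are the sums over the modes 1, ..., N. *)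
Definition Psi f (n : nat) (t : R) : R :=
  \int[lebesgue_measure]_(s in `]0, t[)
    ((t - s) `^ (alpha - 1) *
     mittag_leffler alpha alpha (- lam n ^+ 2 * (t - s) `^ alpha) *
     L2inner (f s) (phi n)).

Definition Upsilon_coef h f (n : nat) : R :=
  L2inner h (phi n) - Psi f n tau.

Definition Upsilon h f : L2 Om :=
  L2_series (fun n => Upsilon_coef h f n *: phi n).

Definition Upsilon_trunc (N : nat) h f : L2 Om :=
  \sum_(n < N) Upsilon_coef h f n *: phi n.

Definition symbol (n : nat) : R :=
  mittag_leffler alpha 1 (- lam n ^+ 2 * tau `^ alpha).

Definition forward_op g : L2 Om :=
  L2_series (fun n => (symbol n * L2inner g (phi n)) *: phi n).

Definition Hp_norm (p : R) g : \bar R :=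
  ((\sum_(0 <= n <oo) (lam n `^ (2 * p) * L2inner g (phi n) ^+ 2)%:E) `^ 2^-1)%E.

Definition source_set (rho p : R) : set (L2 Om) :=
  [set g | (Hp_norm p g <= rho%:E)%E].

(* Fourier truncation regularized solution g^{delta,N}, for h, f the noisy data. *)
Definition g_trunc (N : nat) h f : L2 Om :=
  \sum_(n < N) (Upsilon_coef h f n / symbol n) *: phi n.

Definition discrepancy (mu delta : R) h f (N : nat) :=
  [/\ (0 < N)%N,
      L2norm (Upsilon h f - Upsilon_trunc N h f) <= mu * delta &
      mu * delta < L2norm (Upsilon h f - Upsilon_trunc N.-1 h f)].

End problem.

(* Main.v *)
(** The discrepancy principle forces lambda_N <= C (rho / delta)^(1/(p+2)).  Hence
    the noise, amplified by 1/symbol on the modes up to N, and the tail of [g],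
    controlled by the source condition, are both of order
    rho^(2/(p+2)) delta^(p/(p+2)).

    It rests on the decay E_{a,1}(-x) ~ 1/(1+x) and on E_{a,a}(-x) >= 0 for
    0 < a < 1.  Both come from a discrete model.  For small y >= 0 let r and u be
    the coefficient sequences of the power series ((1-z)^a + y)^(-1) and
    (1-z)^(a-1) ((1-z)^a + y)^(-1).  As (1-z)^a = 1 - sum_(j>0) b_j z^j with
    b_j >= 0, the recurrence (1+y) r_n = [n=0] + sum_(j>0) b_j r_(n-j) gives
    r >= 0; the other identities between these series give
    u_n = 1 - y (r_0 + ... + r_n), hence two-sided bounds on u_n.  With
    y = x n^(-a), Gauss's product formula for Gamma and Tannery's theorem show
    that u_n and n^(1-a) r_n tend to E_{a,1}(-x) and E_{a,a}(-x). *)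

Require Import Defs.
From mathcomp Require Import all_boot all_order all_algebra.
From mathcomp Require Import all_classical all_reals all_analysis.
From mathcomp Require Import measurable_realfun ess_sup_inf ring lra.

Set Implicit Arguments.
Unset Strict Implicit.
Unset Printing Implicit Defensive.

Import Order.TTheory GRing.Theory Num.Theory.
Import numFieldNormedType.Exports.

Local Open Scope classical_set_scope.
Local Open Scope ring_scope.

(** * Gamma and Mittag-Leffler functions *)

(** The power series of E_{a,b} alternates at negative arguments and shows neither sign nor decay;
    the discrete model replaces complete monotonicity and contour integrals by identities between
    formal power series followed by a limit. The sign of E_{a,a} matters because the Duhamel kernel
    is the derivative of lambda_n^(-2) E_{a,1}: being nonnegative, its L^1 norm is its integral, at
    most lambda_n^(-2). An error in f thus costs lambda_n^(-4) in each squared coefficient, whence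
    theta. The errors in h and f are separated by (x - y)^2 <= 2 x^2 + 2 y^2, so the noise in the
    squared norm of Upsilon is 2 delta^2. The tail of the noisy data before the last retained mode
    exceeds mu^2 delta^2; the surplus mu^2 - 2 > 0 must come from the exact data, which the source
    condition bounds by a negative power of lambda_N. All estimates concern coefficient sequences
    and squares of norms. Since a divergent L^2 series is given the value 0, completeness of
    L^2(Omega) is needed before the coefficients of Upsilon can be read off. *)

Section gamma.
Context {R : realType}.
Implicit Types (a b s t : R) (n : nat).
Local Notation mu := (@lebesgue_measure R).

(** Euler's integral with values in the extended reals, so that the functional equation and the
    convexity bound can be proved first and finiteness deduced from them. *)
Definition gammaI a : \bar R :=
  (\int[mu]_(t in `]0%R, +oo[) (t `^ (a - 1) * expR (- t))%:E)%E.

Lemma gammaI_ge0 a : (0 <= gammaI a)%E.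
Proof.
by apply: integral_ge0 => t _; rewrite lee_fin mulr_ge0 ?powR_ge0 ?expR_ge0.
Qed.

Lemma measurable_gamma_integrand a (D : set R) :
  measurable_fun D (fun t : R => t `^ a * expR (- t)).
Proof.
apply: measurable_funTS; apply: measurable_funM; first exact: measurable_powR.
apply: measurableT_comp => //; exact: measurable_expR.
Qed.

Lemma powR_expRN_cvg0 a : 0 < a -> n.+1%:R `^ a * expR (- n.+1%:R) @[n --> \oo] --> (0 : R).
Proof.
move=> a0; pose k := (Num.truncn a).+1.
apply: (@squeeze_cvgr _ _ _ _ (fun=> 0) (fun n => k.+1`!%:R * n.+1%:R^-1)); last 2 first.
- exact: cvg_cst.
- rewrite -[X in _ --> X](mulr0 k.+1`!%:R); apply: cvgM; first exact: cvg_cst.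
  exact: cvg_harmonic.
near=> n; apply/andP; split; first by rewrite mulr_ge0 ?powR_ge0 ?expR_ge0.
have n1 : 1 <= n.+1%:R :> R by rewrite ler1n.
have h1 : n.+1%:R `^ a <= n.+1%:R ^+ k :> R.
  by rewrite -powR_mulrn// ler_powR// ltW// truncnS_gt.
have h2 : n.+1%:R ^+ k.+1 / k.+1`!%:R <= expR n.+1%:R :> R.
  by apply: le_trans (@expR_ge1Dxn _ n.+1%:R k _) => //; rewrite lerDr.
rewrite expRN ler_pdivrMr ?expR_gt0//; apply: (le_trans h1).
rewrite -ler_pdivrMl; last by rewrite mulr_gt0// ?ltr0n ?fact_gt0 ?invr_gt0.
apply: le_trans h2; rewrite invfM invrK exprS.
by rewrite le_eqVlt; apply/orP; left; apply/eqP; ring.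
Unshelve. all: end_near. Qed.

(** An exhaustion by compact intervals away from 0: integration by parts is done on each of them,
    and monotone convergence carries it to the half-line. *)
Lemma bigcup_itv0y : \bigcup_n [set` `[n.+1%:R^-1, n.+2%:R]] = [set` `]0%R, +oo[] :> set R.
Proof.
apply/seteqP; split => [x [n _] /=|x /=].
  rewrite !in_itv/= andbT => /andP[+ _]; apply: lt_le_trans.
  by rewrite invr_gt0.
rewrite in_itv/= andbT => x0; exists (maxn (Num.truncn x) (Num.truncn x^-1)) => //=.
rewrite in_itv/= invf_ple ?posrE//.
apply/andP; split; (apply: le_trans (ltW (truncnS_gt _)) _); rewrite ler_nat.
  by rewrite ltnS leq_maxr.
by rewrite ltnS; apply: leq_trans (leq_maxl _ _) _.
Qed.

Lemma nondecreasing_itv0y : nondecreasing_seq (fun n => [set` `[n.+1%:R^-1, n.+2%:R]] : set R).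
Proof.
move=> m n mn; apply/subsetPset => x /=; rewrite !in_itv/= => /andP[h1 h2].
apply/andP; split.
  by apply: le_trans h1; rewrite lef_pV2 ?posrE// ler_nat.
by apply: le_trans h2 _; rewrite ler_nat.
Qed.

Lemma gammaI_cvg a :
  (\int[mu]_(t in `[n.+1%:R^-1%R, n.+2%:R%R]) (t `^ (a - 1) * expR (- t))%:E)%E
   @[n --> \oo] --> gammaI a.
Proof.
rewrite /gammaI -bigcup_itv0y; apply: ge0_nondecreasing_set_cvg_integral.
- exact: nondecreasing_itv0y.
- by move=> i; exact: measurable_itv.
- by move=> i; apply/measurable_EFinP; exact: measurable_gamma_integrand.
- by move=> i x _; rewrite lee_fin mulr_ge0 ?powR_ge0 ?expR_ge0.
Qed.

Lemma derivable_oo_LRcontinuousW (F : R -> R) (a b : R) : a < b ->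
  (forall x, a <= x <= b -> derivable F x 1) -> derivable_oo_LRcontinuous F a b.
Proof.
move=> ab dF; have cF x : a <= x <= b -> {for x, continuous F}.
  by move=> xab; apply: differentiable_continuous; exact/derivable1_diffP/dF.
split.
- by move=> x /=; rewrite in_itv/= => /andP[ax xb]; apply: dF; rewrite !ltW.
- by apply: cvg_at_right_filter; apply: cF; rewrite lexx ltW.
- by apply: cvg_at_left_filter; apply: cF; rewrite lexx ltW.
Qed.

Lemma within_continuousW (F : R -> R) (a b : R) :
  (forall x, a <= x <= b -> {for x, continuous F}) -> {within `[a, b], continuous F}.
Proof.
move=> cF; apply: continuous_in_subspaceT => x; rewrite inE/= in_itv/=; exact: cF.
Qed.

Lemma powR_continuous a (x : R) : 0 < x -> {for x, continuous (@powR R ^~ a)}.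
Proof.
move=> x0; apply: differentiable_continuous; apply/derivable1_diffP.
by apply: derivable_powR; rewrite in_itv/= x0.
Qed.

Lemma is_derive_expRN (x : R) : is_derive x 1 (fun t : R => expR (- t)) (- expR (- x)).
Proof.
have h := is_derive1_comp (f := @expR R) (g := -%R) (x := x).
rewrite -mulrN1; apply: h.
Qed.

Lemma gammaI_parts a (x y : R) : 0 < a -> 0 < x -> x < y ->
  (a%:E * (\int[mu]_(t in `[x, y]) (t `^ (a - 1) * expR (- t))%:E) =
   (y `^ a * expR (- y) - x `^ a * expR (- x))%:E +
   \int[mu]_(t in `[x, y]) (t `^ (a + 1 - 1) * expR (- t))%:E)%E.
Proof.
move=> a0 x0 xy.
have pos z : x <= z <= y -> 0 < z by move=> /andP[+ _]; exact: lt_le_trans.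
have cE : continuous (fun t : R => expR (- t)).
  by move=> z; apply: continuous_comp; [exact: opp_continuous|exact: continuous_expR].
have igr b : mu.-integrable `[x, y] (fun t : R => (t `^ b * expR (- t))%:E).
  apply: continuous_compact_integrable; first exact: segment_compact.
  apply: within_continuousW => z /pos z0; apply: cvgM; last exact: cE.
  exact: powR_continuous.
have := @integration_by_parts R (@powR R ^~ a) (fun t => - expR (- t))
   (fun t => a * t `^ (a - 1)) (fun t => expR (- t)) x y xy.
rewrite addrK => ->; first last.
- move=> z /=; rewrite in_itv/= => _; rewrite derive1E.
  have h := is_derive_expRN z.
  by rewrite (@derive_val _ _ _ _ _ _ _ (is_deriveN h)) opprK.
- apply: (derivable_oo_LRcontinuousW xy) => z _; apply: derivableN.
  exact: (@ex_derive _ _ _ _ _ _ _ (is_derive_expRN z)).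
- by apply: within_continuousW => z _; exact: cE.
- by move=> z; rewrite in_itv/= => /andP[xz _]; apply: powR_derive1;
    rewrite in_itv/= (lt_trans x0 xz).
- apply: (derivable_oo_LRcontinuousW xy) => z /pos z0.
  by apply: derivable_powR; rewrite in_itv/= z0.
- apply: within_continuousW => z /pos z0; apply: cvgM; first exact: cvg_cst.
  exact: powR_continuous.
have -> : (\int[mu]_(t in `[x, y]) (a * t `^ (a - 1) * - expR (- t))%:E =
    (- a)%:E * \int[mu]_(t in `[x, y]) (t `^ (a - 1) * expR (- t))%:E)%E.
  rewrite -integralZl//.
  by apply: eq_integral => t _; rewrite -EFinM; congr EFin; ring.
set I := (\int[mu]_(t in _) _)%E; have : I \is a fin_num.
  by apply: integrable_fin_num => //; exact: igr.
case: I => // r _; rewrite -!EFinM -?EFinN -?EFinD -?EFinB; congr EFin; ring.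
Qed.

Lemma gammaI_add1 a : 0 < a -> (gammaI (a + 1) = a%:E * gammaI a)%E.
Proof.
move=> a0.
have cB : ((n.+2%:R : R) `^ a * expR (- n.+2%:R) - n.+1%:R^-1 `^ a * expR (- n.+1%:R^-1))
    @[n --> \oo] --> (0 : R).
  rewrite -[X in _ --> X]subr0; apply: cvgB.
    by have := powR_expRN_cvg0 a0; rewrite -cvg_shiftS.
  apply: (@squeeze_cvgr _ _ _ _ (fun=> 0) (fun n => n.+1%:R^-1 `^ a)); last 2 first.
  - exact: cvg_cst.
  - have /cvg_at_rightP := powR_cvg0 a0; apply; split; last exact: cvg_harmonic.
    by move=> n; rewrite invr_gt0.
  apply: nearW => n; apply/andP; split; first by rewrite mulr_ge0 ?powR_ge0 ?expR_ge0.
  by apply: ler_piMr; rewrite ?powR_ge0// expR_le1 oppr_le0 invr_ge0.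
have h1 := cvgeZl (isT : a%:E \is a fin_num) (@gammaI_cvg a).
have h2 : ((n.+2%:R `^ a * expR (- n.+2%:R) - n.+1%:R^-1 `^ a * expR (- n.+1%:R^-1))%:E +
   \int[mu]_(t in `[n.+1%:R^-1%R, n.+2%:R%R]) (t `^ (a + 1 - 1) * expR (- t))%:E)%E
   @[n --> \oo] --> (0%:E + gammaI (a + 1))%E.
  apply: cvgeD; [|by apply: cvg_EFin; [exact: nearW|exact: cB]|exact: gammaI_cvg].
  by rewrite fin_num_adde_defr.
rewrite add0e in h2; apply: (cvg_unique _ h2); first exact: ereal_hausdorff.
have p n : 0 < n.+1%:R^-1 :> R by rewrite invr_gt0.
have q n : n.+1%:R^-1 < n.+2%:R :> R.
  by rewrite (@le_lt_trans _ _ 1)// ?invf_le1// ?ltr1n ?ler1n.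
by move: h1; under eq_fun => n do rewrite (gammaI_parts a0 (p n) (q n)).
Unshelve. all: end_near. Qed.

Lemma gammaI1 : gammaI 1 = 1%E.
Proof.
rewrite -(integral_exponential_pdf (@ltr01 R)).
rewrite /exponential_pdf.
transitivity (\int[mu]_(x in `[0%R, +oo[) (expR (- x))%:E)%E; last first.
  rewrite integral_mkcond; apply: eq_integral => x _; rewrite !patchE.
  by case: ifP => // _; rewrite mul1r mulN1r.
rewrite /gammaI -integral_itv_obnd_cbnd; last first.
  apply/measurable_EFinP; apply: measurable_funTS.
  exact: (measurableT_comp (@measurable_expR R)).
by apply: eq_integral => x _; rewrite subrr powRr0 mul1r.
Qed.

(** Concavity of y^s, through its tangent at 1. With w the right-hand side, ln z <= z - 1 is applied
    at y / w and 1 / w; the combination with weights s and 1 - s has right-hand side 0. *)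
Lemma powR_le_tangent (y s : R) : 0 < y -> 0 <= s <= 1 -> y `^ s <= 1 - s + s * y.
Proof.
move=> y0 /andP[s0 s1].
have w0 : 0 < 1 - s + s * y.
  have [->|sn0] := eqVneq s 0; first by rewrite subr0 mul0r addr0.
  by rewrite ltr_wpDl// ?subr_ge0// mulr_gt0// lt_def sn0.
have lnB (z : R) : 0 < z -> ln z <= z - 1.
  by move=> z0; rewrite -[in ln z](subrKC 1 z); apply: le_ln1Dx; lra.
rewrite -ler_ln ?posrE ?powR_gt0// ln_powR.
set w := 1 - s + s * y in w0 *.
have h1 := lnB _ (divr_gt0 y0 w0); have h2 := lnB _ (divr_gt0 ltr01 w0).
rewrite !ln_div ?posrE// ln1 in h1 h2.
have : s * (ln y - ln w) + (1 - s) * (0 - ln w) <= s * (y / w - 1) + (1 - s) * (1 / w - 1).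
  by apply: lerD; rewrite ler_wpM2l// subr_ge0.
have -> : s * (y / w - 1) + (1 - s) * (1 / w - 1) = (1 - s + s * y) / w - 1 by field; rewrite
    gt_eqF.
rewrite -/w divff ?gt_eqF// subrr; lra.
Qed.

(** Integrates the tangent bound t^s <= x^s (1 - s + s t / x). The point x is left free: x = 1
    serves for finiteness, and x = a gives the sharp form Gamma(a + s) <= a^s Gamma(a). *)
Lemma gammaI_le a s (x : R) : 0 < a -> 0 <= s <= 1 -> 0 < x ->
  (gammaI (a + s) <= (x `^ s)%:E * ((1 - s)%:E * gammaI a + (s / x)%:E * gammaI (a + 1)))%E.
Proof.
move=> a0 /andP[s0 s1] x0.
have I0 b t : (0 <= (t `^ (b - 1) * expR (- t))%:E)%E.
  by rewrite lee_fin mulr_ge0 ?powR_ge0 ?expR_ge0.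
have mI b : measurable_fun (`]0%R, +oo[%classic : set R) (fun t : R => (t `^ (b - 1) * expR (-
    t))%:E).
  by apply/measurable_EFinP; exact: measurable_gamma_integrand.
have sx0 : 0 <= s / x by rewrite divr_ge0// ltW.
have os0 : 0 <= 1 - s by rewrite subr_ge0.
rewrite /gammaI -!ge0_integralZl//; last 2 first.
- exact: mI.
- exact: mI.
rewrite -ge0_integralD//; last 4 first.
- by move=> t _; rewrite mule_ge0.
- by apply: measurable_funeM; exact: mI.
- by move=> t _; rewrite mule_ge0.
- by apply: measurable_funeM; exact: mI.
rewrite -ge0_integralZl//; last 3 first.
- by apply: emeasurable_funD; apply: measurable_funeM; exact: mI.
- by move=> t _; rewrite adde_ge0// mule_ge0.
- by rewrite lee_fin powR_ge0.
apply: ge0_le_integral => //.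
- exact: mI.
- by apply: measurable_funeM; apply: emeasurable_funD; apply: measurable_funeM; exact: mI.
move=> t /=; rewrite in_itv/= andbT => t0.
suff : t `^ (a + s - 1) * expR (- t) <= x `^ s * ((1 - s) * (t `^ (a - 1) * expR (- t)) +
    s / x * (t `^ (a + 1 - 1) * expR (- t))) by rewrite -lee_fin; exact.
rewrite addrK.
have -> : t `^ a = t `^ (a - 1) * t by rewrite mulrC mulr_powRB1// ltW.
have -> : t `^ (a + s - 1) = t `^ (a - 1) * t `^ s.
  by rewrite -powRD; [congr (_ `^ _); ring|rewrite (gt_eqF t0) implybT].
have h : t `^ s <= x `^ s * (1 - s + s / x * t).
  have -> : t `^ s = x `^ s * (t / x) `^ s.
    by rewrite -powRM ?divr_ge0 ?ltW// mulrCA divff ?gt_eqF// mulr1.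
  rewrite ler_wpM2l ?powR_ge0// -mulrA [x^-1 * t]mulrC.
  by apply: powR_le_tangent; rewrite ?divr_gt0// s0.
have := ler_wpM2l (mulr_ge0 (powR_ge0 t (a - 1)) (expR_ge0 (- t))) h.
by congr (_ <= _); ring.
Qed.

(** Integers follow from the functional equation, reals above 1 by interpolating between
    neighbouring integers, and the remaining ones by reading the functional equation backwards: an
    infinite value at b would make the value at b + 1 infinite. *)
Lemma gammaI_fin a : 0 < a -> gammaI a \is a fin_num.
Proof.
have step b : 0 < b -> gammaI (b + 1) \is a fin_num -> gammaI b \is a fin_num.
  move=> b0; rewrite gammaI_add1// !ge0_fin_numE ?gammaI_ge0//; last first.
    by rewrite mule_ge0 ?gammaI_ge0// lee_fin ltW.
  by apply: contraTT; rewrite -!leNgt !leye_eq => /eqP ->; rewrite gt0_muley.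
have nat_fin n : gammaI n.+1%:R \is a fin_num.
  elim: n => [|n IH]; first by rewrite gammaI1.
  by rewrite -natr1 gammaI_add1 ?ltr0n// fin_numM.
have ge1_fin b : 1 <= b -> gammaI b \is a fin_num.
  move=> b1; pose n := (Num.truncn b).
  have /andP[nb bn] := truncn_itv (le_trans ler01 b1).
  have n1 : (0 < n)%N by rewrite truncn_gt0.
  have sb : 0 <= b - n%:R <= 1.
    by rewrite subr_ge0 nb lerBlDl natr1 ltW.
  have := @gammaI_le n%:R (b - n%:R) 1 _ sb ltr01.
  rewrite ltr0n => /(_ n1); rewrite subrKC => h.
  rewrite ge0_fin_numE ?gammaI_ge0//; apply: le_lt_trans h _.
  rewrite ltey_eq fin_numM// fin_numD !fin_numM//.
    by rewrite natr1; exact: nat_fin.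
  by rewrite -(prednK n1); exact: nat_fin.
by move=> a0; apply: step => //; apply: ge1_fin; rewrite lerDr ltW.
Qed.

Lemma GammaE a : 0 < a -> (Gamma a)%:E = gammaI a.
Proof. by move=> a0; rewrite /Gamma /Rintegral fineK// gammaI_fin. Qed.

Lemma Gamma1 : Gamma (1 : R) = 1.
Proof. by apply: EFin_inj; rewrite GammaE// gammaI1. Qed.

Lemma Gamma_add1 a : 0 < a -> Gamma (a + 1) = a * Gamma a.
Proof.
move=> a0; apply: EFin_inj; rewrite EFinM !GammaE//; first exact: gammaI_add1.
by rewrite addr_gt0.
Qed.

Lemma Gamma_le_powR a s : 0 < a -> 0 <= s <= 1 -> Gamma (a + s) <= a `^ s * Gamma a.
Proof.
move=> a0 s01; have as0 : 0 < a + s by rewrite ltr_wpDr//; case/andP: s01.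
have := gammaI_le a0 s01 a0.
rewrite -(GammaE as0) -(GammaE a0) -(GammaE (addr_gt0 a0 ltr01)) Gamma_add1//.
rewrite -!EFinM lee_fin.
by congr (_ <= _); field; rewrite gt_eqF.
Qed.

(** Positivity is inherited from an integer argument: Gamma(n + 2) is bounded by a positive multiple
    of Gamma(a + 1), where n is the integer part of a. *)
Lemma Gamma_gt0 a : 0 < a -> 0 < Gamma a.
Proof.
have step b : 0 < b -> 0 < Gamma (b + 1) -> 0 < Gamma b.
  by move=> b0; rewrite (Gamma_add1 b0) pmulr_rgt0.
have stepn n b : 0 < b -> 0 < Gamma b -> 0 < Gamma (b + n%:R).
  move=> b0 Gb; elim: n => [|n IH]; first by rewrite addr0.
  have bn : 0 < b + n%:R by rewrite ltr_wpDr.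
  by rewrite -natr1 addrA (Gamma_add1 bn) mulr_gt0.
move=> a0; pose n := Num.truncn a.
have /andP[na an] := truncn_itv (ltW a0).
have h : Gamma n.+2%:R <= (a + 1) `^ (n.+1%:R - a) * Gamma (a + 1).
  have -> : n.+2%:R = a + 1 + (n.+1%:R - a) :> R by rewrite -[n.+2%:R]natr1; ring.
  apply: Gamma_le_powR; first by rewrite addr_gt0.
  by rewrite subr_ge0 ltW//= lerBlDr -natr1 [leLHS]addrC lerD2l.
apply: step => //; rewrite -(pmulr_rgt0 _ (powR_gt0 (n.+1%:R - a) (_ : 0 < a + 1))) ?addr_gt0//.
apply: lt_le_trans h; rewrite -add1n natrD; apply: stepn => //.
by rewrite Gamma1.
Qed.
End gamma.

Lemma powR_div (R : realType) (x y r : R) : 0 <= x -> 0 < y -> (x / y) `^ r = x `^ r / y `^ r.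
Proof.
move=> x0 y0; apply: (mulIf (lt0r_neq0 (powR_gt0 r y0))) => /=.
have y0' := ltW y0; have yN0 := lt0r_neq0 y0.
by rewrite divfK ?lt0r_neq0 ?powR_gt0// -powRM ?divr_ge0// divfK.
Qed.

(** * Binomial coefficients and Gauss's product formula *)

Section rising.
Context {R : realType}.
Implicit Types (a b s t : R) (n : nat).

(* The coefficient of z^n in (1 - z)^(-s). *)
Definition rising n s : R := \prod_(j < n) ((s + j%:R) / j.+1%:R).

Lemma rising0 s : rising 0 s = 1.
Proof. by rewrite /rising big_ord0. Qed.

Lemma risingS n s : rising n.+1 s = rising n s * ((s + n%:R) / n.+1%:R).
Proof. by rewrite /rising big_ord_recr. Qed.

Lemma rising_gt0 n s : 0 < s -> 0 < rising n s.
Proof.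
by move=> s0; apply: prodr_gt0 => j _; rewrite divr_gt0// ltr_wpDr.
Qed.

Lemma rising1 n : rising n 1 = 1.
Proof. by apply: big1 => j _; rewrite addrC natr1 divff. Qed.

Lemma rising_at0 n : rising n.+1 0 = 0.
Proof. by rewrite /rising big_ord_recl /= addr0 !mul0r. Qed.

Lemma rising_add1 n s : rising n (s + 1) * s = rising n s * (s + n%:R).
Proof.
elim: n => [|n IH]; first by rewrite !rising0 addr0.
rewrite !risingS mulrAC IH -natr1; field.
by rewrite natr1.
Qed.

(** These are the coefficients of (1 - z)^a beyond the constant term; their sign drives the
    positivity of the resolvent sequence. *)
Lemma rising_oppr_le0 n a : 0 < a <= 1 -> rising n.+1 (- a) <= 0.
Proof.
move=> /andP[a0 a1]; rewrite /rising big_ord_recl /= addr0 divr1.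
rewrite mulNr oppr_le0; apply: mulr_ge0; first exact: ltW.
by apply: prodr_ge0 => j _; rewrite divr_ge0// addrC subr_ge0 (le_trans a1)// ler1n.
Qed.

(** The coefficients of (1 - z)^(-s) (1 - z)^(-t). After multiplication by n + 1 the induction is a
    Leibniz rule: in the j-th term s + t + n splits as (s + j) + (t + n - j). *)
Lemma Chu_Vandermonde n s t :
  rising n (s + t) = \sum_(j < n.+1) rising j s * rising (n - j) t.
Proof.
elim: n => [|n IH]; first by rewrite big_ord1 !rising0 mulr1.
have n0 : n.+1%:R != 0 :> R by rewrite pnatr_eq0.
apply: (mulfI n0); rewrite risingS mulrCA [X in _ * X]mulrC divfK// IH mulr_suml.
transitivity (\sum_(j < n.+1) (j.+1%:R * rising j.+1 s * rising (n - j) t +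
    rising j s * ((n - j).+1%:R * rising (n - j).+1 t))).
  apply: eq_bigr => j _; rewrite !risingS.
  have -> : n%:R = j%:R + (n - j)%:R :> R by rewrite -natrD subnKC// -ltnS.
  by field; rewrite !nat1r !pnatr_eq0.
rewrite big_split/= mulr_sumr.
rewrite [RHS](_ : _ = \sum_(j < n.+2) (j%:R * rising j s * rising (n.+1 - j) t) +
    \sum_(j < n.+2) (rising j s * ((n.+1 - j)%:R * rising (n.+1 - j) t))); last first.
  rewrite -big_split/=; apply: eq_bigr => j _.
  have -> : n.+1%:R = j%:R + (n.+1 - j)%:R :> R by rewrite -natrD subnKC// -ltnS.
  ring.
congr (_ + _).
  by rewrite [RHS]big_ord_recl/= !mul0r add0r; apply: eq_bigr => j _; rewrite /bump/= add1n subSS.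
rewrite [RHS]big_ord_recr/= subnn mul0r mulr0 addr0; apply: eq_bigr => j _.
by rewrite subSn// -ltnS.
Qed.

Lemma rising_Gamma n s : 0 < s -> rising n s * n`!%:R * Gamma s = Gamma (s + n%:R).
Proof.
move=> s0; elim: n => [|n IH]; first by rewrite rising0 !mul1r addr0.
have sn : 0 < s + n%:R by rewrite ltr_wpDr.
rewrite -natr1 addrA (Gamma_add1 sn) -IH risingS factS natrM; field.
by rewrite nat1r pnatr_eq0.
Qed.

(** Controls the quotient of consecutive terms of the discrete series, whose index grows by a. Both
    Gamma quotients come from [Gamma_le_powR], the second through the step 1 - a from s + a to s +
    1. *)
Lemma rising_ratio n a s : 0 <= a <= 1 -> 0 < s ->
  rising n (s + a) <= rising n s * ((s + n%:R) `^ a * (s + 1) `^ (1 - a) / s).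
Proof.
move=> /andP[a0 a1] s0.
have sa : 0 < s + a by rewrite ltr_wpDr.
have sn : 0 < s + n%:R by rewrite ltr_wpDr.
have nf : 0 < n`!%:R :> R by rewrite ltr0n fact_gt0.
have h1 : Gamma (s + n%:R + a) <= (s + n%:R) `^ a * Gamma (s + n%:R).
  by apply: Gamma_le_powR; rewrite ?a0.
have h2 : Gamma (s + 1) <= (s + 1) `^ (1 - a) * Gamma (s + a).
  have -> : s + 1 = s + a + (1 - a) by ring.
  apply: le_trans (Gamma_le_powR sa _) _; first by rewrite subr_ge0 a1/= lerBlDr lerDl.
  have -> : s + a + (1 - a) = s + 1 by ring.
  rewrite ler_pM2r ?Gamma_gt0//; apply: ge0_ler_powR; rewrite ?nnegrE ?subr_ge0//.
  - exact: ltW.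
  - by rewrite addr_ge0// ltW.
  - by rewrite lerD2l.
rewrite (Gamma_add1 s0) in h2.
rewrite addrAC -!rising_Gamma// in h1.
have Gs := Gamma_gt0 s0; have Gsa := Gamma_gt0 sa.
rewrite -(ler_pM2r (mulr_gt0 nf Gsa)) mulrA; apply: le_trans h1 _.
rewrite [leLHS](_ : _ = rising n s * n`!%:R * (s + n%:R) `^ a / s * (s * Gamma s)); last first.
  by field; rewrite gt_eqF.
rewrite [leRHS](_ : _ = rising n s * n`!%:R * (s + n%:R) `^ a / s *
   ((s + 1) `^ (1 - a) * Gamma (s + a))); last by field; rewrite gt_eqF.
rewrite ler_wpM2l// !mulr_ge0 ?powR_ge0 ?ltW// ?rising_gt0// invr_gt0//.
Qed.

(** [Gamma_le_powR] is used from n to n + s and from n + s to n + 1; since Gamma(n + 1) = n!, the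
    two bounds enclose the sequence up to a factor 1 - s / (s + n). *)
Lemma Gauss_le1 s : 0 < s <= 1 ->
  rising n.+1 s * n.+1%:R `^ (1 - s) @[n --> \oo] --> (Gamma s)^-1.
Proof.
move=> /andP[s0 s1]; have Gs := Gamma_gt0 s0.
have s01 : 0 <= s <= 1 by rewrite ltW.
have os01 : 0 <= 1 - s <= 1 by rewrite subr_ge0 s1 lerBlDr lerDl ltW.
apply: (@squeeze_cvgr _ _ _ _ (fun n => (1 - s / (s + n.+1%:R)) / Gamma s) (fun=> (Gamma
    s)^-1)); last 2 first.
- rewrite -[X in _ --> X]mul1r; apply: cvgMr_tmp; rewrite -[X in _ --> X]subr0.
  apply: cvgB; first exact: cvg_cst.
  rewrite -(mulr0 s); apply: cvgMl_tmp.
  apply: (@squeeze_cvgr _ _ _ _ (fun=> 0) (@harmonic R)); last 2 first.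
  + exact: cvg_cst.
  + exact: cvg_harmonic.
  apply: nearW => n; have sn : 0 < s + n.+1%:R by rewrite addr_gt0.
  by rewrite invr_ge0 (ltW sn)/= lef_pV2 ?posrE// lerDr ltW.
- exact: cvg_cst.
apply: nearW => m; set n := m.+1.
have n0 : 0 < n%:R :> R by rewrite ltr0n.
have sn : 0 < s + n%:R by rewrite addr_gt0.
have nf : 0 < n`!%:R :> R by rewrite ltr0n fact_gt0.
have Gn : Gamma (n%:R + 1 : R) = n`!%:R.
  by rewrite addrC -rising_Gamma// rising1 Gamma1 mul1r mulr1.
have h1 : Gamma (n%:R + s) <= n%:R `^ s * Gamma n%:R by apply: Gamma_le_powR.
have h2 : Gamma (s + n%:R + (1 - s)) <= (s + n%:R) `^ (1 - s) * Gamma (s + n%:R).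
  by apply: Gamma_le_powR.
rewrite (_ : s + n%:R + (1 - s) = n%:R + 1) in h2; last ring.
rewrite Gn -rising_Gamma// in h2; rewrite addrC -rising_Gamma// in h1.
rewrite (Gamma_add1 n0) in Gn.
apply/andP; split.
  rewrite ler_pdivrMr//.
  have D0 : 0 < (s + n%:R) `^ (1 - s) by rewrite powR_gt0.
  have h3 : 1 - s / (s + n%:R) <= n%:R `^ (1 - s) / (s + n%:R) `^ (1 - s).
    rewrite -powR_div ?ler0n//.
    have -> : 1 - s / (s + n%:R) = n%:R / (s + n%:R) by field; rewrite gt_eqF.
    apply: ger1_powR; last by case/andP: os01.
    apply/andP; split; first exact: divr_gt0.
    by rewrite ler_pdivrMr// mul1r lerDr ltW.
  have h4 : 1 <= (s + n%:R) `^ (1 - s) * (rising n s * Gamma s).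
    rewrite -(ler_pM2r nf) mul1r; apply: le_trans h2 _.
    by rewrite le_eqVlt; apply/orP; left; apply/eqP; ring.
    apply: le_trans h3 _; rewrite ler_pdivrMr//.
  have := ler_wpM2l (powR_ge0 n%:R (1 - s)) h4; rewrite mulr1 => /le_trans; apply.
  by rewrite le_eqVlt; apply/orP; left; apply/eqP; ring.
have P0 : 0 < n%:R `^ s :> R by rewrite powR_gt0.
have Gn0 : 0 < Gamma n%:R :> R by apply: Gamma_gt0.
rewrite -[leRHS]mul1r ler_pdivlMr// -(ler_pM2r P0) mul1r -(ler_pM2r Gn0).
apply: le_trans h1; rewrite -Gn.
have e : n%:R `^ (1 - s) * n%:R `^ s = n%:R :> R.
  by rewrite -powRD ?(gt_eqF n0) ?implybT// subrK powRr1// ltW.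
rewrite [leLHS](_ : _ = rising n s * (n%:R `^ (1 - s) * n%:R `^ s) * Gamma s * Gamma n%:R);
    last ring.
by rewrite e le_eqVlt; apply/orP; left; apply/eqP; ring.
Qed.

Lemma Gauss_Gamma s : 0 < s ->
  rising n.+1 s * n.+1%:R `^ (1 - s) @[n --> \oo] --> (Gamma s)^-1.
Proof.
suff h k : forall s, 0 < s <= k.+1%:R ->
    rising n.+1 s * n.+1%:R `^ (1 - s) @[n --> \oo] --> (Gamma s)^-1.
  by move=> s0; apply: (h (Num.truncn s)); rewrite s0 ltW// truncnS_gt.
elim: k => [|k IH] {}s; first exact: Gauss_le1.
move=> /andP[s0 sk].
have [s1|s1] := leP s 1; first by apply: Gauss_le1; rewrite s0.
pose t := s - 1; have t0 : 0 < t by rewrite subr_gt0.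
have -> : s = t + 1 by rewrite subrK.
have tk : 0 < t <= k.+1%:R by rewrite t0 lerBlDr natr1.
have {IH} := IH _ tk.
rewrite (Gamma_add1 t0) invfM => h.
have h1 : (n.+1%:R^-1 + t^-1 : R) @[n --> \oo] --> t^-1.
  by rewrite -[X in _ --> X]add0r; apply: cvgD; [exact: cvg_harmonic|exact: cvg_cst].
refine (cvg_trans _ (cvgM h1 h)); apply: near_eq_cvg; apply: nearW => n /=.
apply/esym.
have n0 : 0 < n.+1%:R :> R by rewrite ltr0n.
have -> : 1 - (t + 1) = (1 - t) - 1 by ring.
have e : n.+1%:R `^ (1 - t) = n.+1%:R * n.+1%:R `^ (1 - t - 1) :> R.
  by rewrite [in RHS]powRB ?(gt_eqF n0) ?implybT// powRr1 ?(ltW n0)// mulrCA divff ?mulr1// gt_eqF.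
rewrite e; apply: (mulIf (lt0r_neq0 t0)) => /=.
rewrite [LHS]mulrAC rising_add1; field.
by rewrite nat1r !gt_eqF.
Qed.
End rising.

(** * Series dominated by a geometric series *)

Section tannery.
Context {R : realType}.
Implicit Types (u v : R^nat) (q C : R).

Lemma cvg_bigsum (I : Type) (r : seq I) (f : I -> R^nat) (l : I -> R) :
  (forall i, f i n @[n --> \oo] --> l i) ->
  \sum_(i <- r) f i n @[n --> \oo] --> \sum_(i <- r) l i.
Proof.
move=> fl; elim: r => [|i r IH].
  by rewrite big_nil; under eq_fun do rewrite big_nil; exact: cvg_cst.
by rewrite big_cons; under eq_fun do rewrite big_cons; exact: cvgD.
Qed.

Lemma geometric_dominated_cvg u q C : 0 < q < 1 -> (forall k, `|u k| <= C * q ^+ k) ->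
  cvgn (series u).
Proof.
move=> /andP[q0 q1] uC; apply: normed_cvg.
apply: (@series_le_cvg _ _ (geometric C q)).
- by move=> n; exact: normr_ge0.
- by move=> n /=; apply: le_trans (uC n).
- by move=> n /=; exact: uC.
- by apply: is_cvg_geometric_series; rewrite ger0_norm// ltW.
Qed.

Lemma geometric_dominated_tail u q C K : 0 < q < 1 -> (forall k, `|u k| <= C * q ^+ k) ->
  `|limn (series u) - series u K| <= C * q ^+ K / (1 - q).
Proof.
move=> q01 uC; have cu := geometric_dominated_cvg q01 uC.
have /andP[q0 q1] := q01.
have C0 : 0 <= C by have := uC 0%N; rewrite expr0 mulr1; exact: le_trans.
have h : (`|series u n - series u K|) @[n --> \oo] --> `|limn (series u) - series u K|.
  by apply: cvg_norm; apply: cvgB; [exact: cu|exact: cvg_cst].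
apply: (cvgr_to_le h); exists K => // n /= Kn.
rewrite sub_series_geq//; apply: le_trans (ler_norm_sum _ _ _) _.
apply: (@le_trans _ _ (\sum_(K <= k < n) C * q ^+ k)).
  by apply: ler_sum => k _; exact: uC.
rewrite -mulr_sumr -mulrA ler_wpM2l//.
rewrite -[X in (_ <= X)%O]mulr1 -(subnKC Kn) geometric_partial_tail.
rewrite mulr1; apply: geometric_le_lim => //; first by rewrite exprn_ge0// ltW.
by rewrite ger0_norm// ltW.
Qed.

(** The constant involves only B, q and K. It is therefore the same for a whole family of sequences
    u, as Tannery's theorem requires. *)
Lemma geometric_dominated_bound (u : R^nat) q (B : R^nat) K :
  0 < q -> (forall k, (k <= K)%N -> `|u k| <= B k) ->
  (forall k, (K <= k)%N -> `|u k.+1| <= q * `|u k|) ->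
  forall k, `|u k| <= (\sum_(i < K.+1) `|B i| / q ^+ i) * q ^+ k.
Proof.
move=> q0 uB uq; set C := \sum_(i < _) _.
have Cl i : (i <= K)%N -> `|B i| <= C * q ^+ i.
  move=> iK; rewrite -ler_pdivrMr ?exprn_gt0//.
  rewrite /C (bigD1 (Ordinal (iK : (i < K.+1)%N)))//= lerDl.
  by apply: sumr_ge0 => j _; rewrite divr_ge0// exprn_ge0// ltW.
elim=> [|k IH]; first exact: le_trans (uB _ _) (le_trans (ler_norm _) (Cl _ _)).
have [kK|Kk] := ltnP k K.
  exact: le_trans (uB _ _) (le_trans (ler_norm _) (Cl _ _)).
apply: le_trans (uq _ Kk) _; rewrite exprS mulrCA ler_wpM2l//; exact: ltW.
Qed.

Lemma ratio_test u q K : 0 < q < 1 ->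
  (forall k, (K <= k)%N -> `|u k.+1| <= q * `|u k|) -> cvgn (series u).
Proof.
move=> q01 uq; apply: (geometric_dominated_cvg q01).
apply: (@geometric_dominated_bound _ _ (fun k => `|u k|) K) => //.
by case/andP: q01.
Qed.

Lemma Tannery (u : nat -> R^nat) (v : R^nat) q C :
  0 < q < 1 -> (forall k, u n k @[n --> \oo] --> v k) ->
  (\forall n \near \oo, forall k, `|u n k| <= C * q ^+ k) ->
  limn (series (u n)) @[n --> \oo] --> limn (series v).
Proof.
move=> q01 uv uC; have /andP[q0 q1] := q01.
have vC k : `|v k| <= C * q ^+ k.
  apply: (cvgr_to_le (cvg_norm (uv k))).
  by apply: filterS uC => n; apply.
have tail0 : C * q ^+ K / (1 - q) @[K --> \oo] --> 0.
  rewrite -[X in _ --> X](mul0r (1 - q)^-1); apply: cvgMr_tmp.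
  by apply: cvg_geometric; rewrite ger0_norm// ltW.
apply/cvgrPdist_le => e e0.
have e3 : 0 < e / 3 by rewrite divr_gt0.
have /cvgrPdist_le/(_ _ e3)[K _ /(_ K (leqnn K))] := tail0.
rewrite sub0r normrN => tK.
have sK : series (u n) K @[n --> \oo] --> series v K.
  rewrite /series/=; apply: cvg_bigsum => k; exact: uv.
have /cvgrPdist_le/(_ _ e3) sKe := sK.
near=> n.
have uCn : forall k, `|u n k| <= C * q ^+ k by near: n.
have h1 := geometric_dominated_tail K q01 vC.
have h2 := geometric_dominated_tail K q01 uCn.
have h3 : `|series v K - series (u n) K| <= e / 3 by near: n.
have h1' := le_trans h1 (le_trans (ler_norm _) tK).
have h2' := le_trans h2 (le_trans (ler_norm _) tK).
have -> : limn (series v) - limn (series (u n)) = (limn (series v) - series v K) +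
   (series v K - series (u n) K) - (limn (series (u n)) - series (u n) K) by ring.
apply: le_trans (ler_normB _ _) _.
have h4 := ler_normD (limn (series v) - series v K) (series v K - series (u n) K).
lra.
Unshelve. all: end_near. Qed.

End tannery.

(** * The discrete model: positivity and two-sided bounds *)

Section mittag_leffler_bounds.
Context {R : realType}.
Variable a : R.
Hypothesis a01 : 0 < a < 1.
Implicit Types (b s t x y z : R) (n j k : nat).

Let a0 : 0 < a. Proof. by case/andP: a01. Qed.
Let a1 : a < 1. Proof. by case/andP: a01. Qed.
Let a01w : 0 <= a <= 1. Proof. by rewrite !ltW. Qed.

(* The coefficient of z^n in (1 - z)^(a - b) / ((1 - z)^a + y), a discrete
   analogue of t^(b - 1) E_{a,b}(- y t^a) at t = n. *)
Definition discrete_ml b y n : R :=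
  limn (series (fun k => (- y) ^+ k * rising n (k%:R * a + b))).

Lemma index_large (D b : R) k : 0 <= b -> ((Num.truncn (D / a)).+1 <= k)%N ->
  D <= k%:R * a + b.
Proof.
move=> b0 Kk; apply: (@le_trans _ _ (k%:R * a)); last by rewrite lerDl.
rewrite -ler_pdivrMr//; apply: le_trans (ltW (truncnS_gt _)) _.
by rewrite ler_nat.
Qed.

Lemma indexS k b : k.+1%:R * a + b = k%:R * a + b + a.
Proof. by rewrite -natr1; ring. Qed.

Lemma discrete_ml_cvg b y n : 0 <= b -> 0 <= y < 1 ->
  cvgn (series (fun k => (- y) ^+ k * rising n (k%:R * a + b))).
Proof.
move=> b0 /andP[y0 y1]; have y1' : 0 < 1 - y by rewrite subr_gt0.
(* The quotient of consecutive terms is at most y (s + n + 1) / s. For s >= D this is at most y (1 +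
   (1 - y) / 2) <= (1 + y) / 2 < 1. *)
pose D := 2 * n.+1%:R / (1 - y).
have D0 : 0 < D by rewrite divr_gt0// mulr_gt0.
apply: (@ratio_test _ _ ((1 + y) / 2) (Num.truncn (D / a)).+1); first lra.
move=> k /(index_large b0) Ds; rewrite indexS; set s := k%:R * a + b in Ds *.
have s0 : 0 < s := lt_le_trans D0 Ds.
rewrite !normrM !normrX normrN (ger0_norm y0).
have sa : 0 < s + a by rewrite addr_gt0.
rewrite (gtr0_norm (rising_gt0 n s0)) (gtr0_norm (rising_gt0 n sa)).
set rho := (s + n%:R) `^ a * (s + 1) `^ (1 - a) / s.
have r0 := rising_gt0 n s0.
suff h : y * rho <= (1 + y) / 2.
  have h1 := ler_wpM2l y0 (rising_ratio n a01w s0).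
  have h2 := ler_wpM2r (ltW r0) h.
  have -> : y ^+ k.+1 * rising n (s + a) = y ^+ k * (y * rising n (s + a)) by rewrite exprS; ring.
  have -> : (1 + y) / 2 * (y ^+ k * rising n s) = y ^+ k * ((1 + y) / 2 * rising n s) by ring.
  rewrite ler_wpM2l ?exprn_ge0//.
  apply: le_trans h1 _; apply: le_trans h2; rewrite -/rho.
  by rewrite le_eqVlt; apply/orP; left; apply/eqP; ring.
have sn0 : 0 < s + n.+1%:R by rewrite addr_gt0.
have h : (s + n%:R) `^ a * (s + 1) `^ (1 - a) <= s + n.+1%:R.
  have -> : s + n.+1%:R = (s + n.+1%:R) `^ a * (s + n.+1%:R) `^ (1 - a).
    rewrite -powRD; last by rewrite subrKC oner_eq0.
    by rewrite subrKC powRr1// ltW.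
  apply: ler_pM; rewrite ?powR_ge0//; apply: ge0_ler_powR.
  - exact: ltW.
  - by rewrite nnegrE addr_ge0// ltW.
  - by rewrite nnegrE ltW.
  - by rewrite lerD2l ler_nat.
  - by rewrite subr_ge0 ltW.
  - by rewrite nnegrE addr_ge0// ltW.
  - by rewrite nnegrE ltW.
  - by rewrite lerD2l ler1n.
rewrite mulrA ler_pdivrMr//.
apply: le_trans (ler_wpM2l y0 h) _.
have h2 : n.+1%:R <= s * ((1 - y) / 2).
  have := ler_wpM2r (ltW (divr_gt0 y1' (@ltr0n R 2))) Ds.
  by apply: le_trans; rewrite le_eqVlt /D; apply/orP; left; apply/eqP; field; rewrite gt_eqF.
have h3 : 0 <= n.+1%:R :> R by [].
nra.
Qed.

(** On generating series this is multiplication by (1 - z)^(-t); t may be negative. *)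
Lemma discrete_ml_conv b t y n : 0 <= b -> 0 <= y < 1 ->
  discrete_ml (b + t) y n = \sum_(j < n.+1) rising (n - j) t * discrete_ml b y j.
Proof.
move=> b0 y01; apply: cvg_lim => //.
have h (j : 'I_n.+1) : rising (n - j) t *
    series (fun k => (- y) ^+ k * rising j (k%:R * a + b)) N @[N --> \oo] -->
    rising (n - j) t * discrete_ml b y j.
  apply: cvgMl_tmp; have := discrete_ml_cvg b0 y01; exact.
have := cvg_bigsum (r := index_enum _) h; rewrite /=; apply: cvg_trans.
apply: near_eq_cvg; apply: nearW => N /=; rewrite /series/=.
under eq_bigr do rewrite mulr_sumr; rewrite exchange_big/=.
apply: eq_bigr => k _; rewrite addrA Chu_Vandermonde mulr_sumr.
by apply: eq_bigr => j _; ring.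
Qed.

(** On generating series, (1 - z)^(-b) is multiplied and divided by (1 - z)^a + y; on the defining
    series, the term k = 0 is split off. *)
Lemma discrete_ml_shift b y n : 0 <= b -> 0 <= y < 1 ->
  discrete_ml b y n = rising n b - y * discrete_ml (b + a) y n.
Proof.
move=> b0 y01; apply: cvg_lim => //.
have ba0 : 0 <= b + a by rewrite addr_ge0// ltW.
have := discrete_ml_cvg (n := n) ba0 y01; rewrite -/(discrete_ml _ _ _) => h.
rewrite -cvg_shiftS; refine (cvg_trans _ (cvgB (cvg_cst (rising n b)) (cvgMl_tmp (a := y) h))).
apply: near_eq_cvg; apply: nearW => N /=; rewrite /series/=; apply/esym.
transitivity (rising n b - y * \sum_(0 <= k < N) (- y) ^+ k * rising n (k%:R * a + (b + a)));
    last by [].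
rewrite big_nat_recl//= expr0 mul1r mul0r add0r mulr_sumr -sumrN; congr (_ + _).
by apply: eq_bigr => k _; rewrite indexS -(addrA _ b a) exprS; ring.
Qed.

Lemma rising_at0E n : rising n (0 : R) = (n == 0)%:R.
Proof. by case: n => [|n]; [rewrite rising0|rewrite rising_at0]. Qed.

Lemma discrete_ml_resolvent_ge0 y n : 0 <= y < 1 -> 0 <= discrete_ml a y n.
Proof.
move=> y01; have /andP[y0 _] := y01.
elim/ltn_ind: n => n IH.
(* The sequence of index b = 0 is computed in two ways: by the shift identity, and with 0 = a - a as
   the convolution of the resolvent sequence with the coefficients of (1 - z)^a. Equating them gives
   the recurrence. *)
have := discrete_ml_shift n (lexx 0) y01; rewrite add0r -[X in discrete_ml X _ _ = _](subrr a).
rewrite (discrete_ml_conv _ _ (ltW a0) y01) big_ord_recr/= subnn rising0 mul1r rising_at0E.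
move=> h; have y10 : 0 < 1 + y by lra.
rewrite -(pmulr_rge0 _ y10).
have -> : (1 + y) * discrete_ml a y n = (n == 0)%:R - \sum_(i < n) rising (n - i) (- a) *
    discrete_ml a y i.
  by rewrite mulrDl mul1r; lra.
rewrite subr_ge0 (@le_trans _ _ 0)//; apply: sumr_le0 => i _.
rewrite mulr_le0_ge0 ?IH//.
have : (0 < n - i)%N by rewrite subn_gt0.
by case: (n - i)%N => // m _; apply: rising_oppr_le0; rewrite a0 ltW.
Qed.

Lemma discrete_ml_sum y n : 0 <= y < 1 ->
  discrete_ml 1 y n = 1 - y * \sum_(j < n.+1) discrete_ml a y j.
Proof.
move=> y01; rewrite (discrete_ml_shift n ler01 y01) rising1 (addrC 1 a).
rewrite (discrete_ml_conv _ _ (ltW a0) y01); congr (_ - _ * _).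
by apply: eq_bigr => j _; rewrite rising1 mul1r.
Qed.

Lemma discrete_ml_nonincr y i j : 0 <= y < 1 -> (i <= j)%N ->
  discrete_ml 1 y j <= discrete_ml 1 y i.
Proof.
move=> y01 ij; have /andP[y0 _] := y01.
rewrite !discrete_ml_sum// lerD2l lerN2 ler_wpM2l//.
rewrite -!(big_mkord xpredT (discrete_ml a y)).
rewrite [leRHS](@big_cat_nat _ _ _ i.+1)//= lerDl.
by apply: sumr_ge0 => k _; exact: discrete_ml_resolvent_ge0.
Qed.

Lemma rising_hockey n s : \sum_(j < n.+1) rising (n - j) s = rising n (s + 1).
Proof.
by rewrite addrC Chu_Vandermonde; apply: eq_bigr => j _; rewrite rising1 mul1r.
Qed.

(** Writing u for the sequence of index 1, the shift identity reads u_n = 1 - y (c * u)_n, with c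
    the coefficients of (1 - z)^(-a). As u is nonincreasing, each u_j in the convolution is at least
    u_n, and the c_j sum to [rising n (a + 1)]. *)
Lemma discrete_ml_upper y n : 0 <= y < 1 ->
  discrete_ml 1 y n * (1 + y * rising n (a + 1)) <= 1.
Proof.
move=> y01; have /andP[y0 _] := y01.
have h := discrete_ml_shift n ler01 y01.
rewrite (discrete_ml_conv _ _ ler01 y01) rising1 in h.
have : discrete_ml 1 y n * rising n (a + 1) <=
    \sum_(j < n.+1) rising (n - j) a * discrete_ml 1 y j.
  rewrite -rising_hockey mulr_sumr; apply: ler_sum => j _.
  rewrite mulrC ler_wpM2l ?(ltW (rising_gt0 _ a0))//.
  by apply: discrete_ml_nonincr => //; rewrite -ltnS.
move=> /(ler_wpM2l y0); rewrite mulrDr mulr1 mulrCA; lra.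
Qed.

Lemma rising_nonincr s i j : 0 < s <= 1 -> (i <= j)%N -> rising j s <= rising i s.
Proof.
move=> /andP[s0 s1].
suff h : nonincreasing_seq (fun n => rising n s) by exact: h.
apply/nonincreasing_seqP => n.
rewrite risingS ler_piMr ?(ltW (rising_gt0 _ s0))//.
by rewrite ler_pdivrMr// mul1r -natr1 addrC lerD2l.
Qed.

(** The sequence u of index 1 is the convolution of the resolvent sequence r with the coefficients
    of (1 - z)^(a - 1), which are nonincreasing. Hence u_n >= [rising n (1 - a)] (r_0 + ... + r_n),
    and y times the last sum is 1 - u_n. *)
Lemma discrete_ml_lower y n : 0 <= y < 1 ->
  rising n (1 - a) <= discrete_ml 1 y n * (y + rising n (1 - a)).
Proof.
move=> y01; have /andP[y0 _] := y01.
have oa : 0 < 1 - a <= 1 by rewrite subr_gt0 a1/= lerBlDr lerDl ltW.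
have h := discrete_ml_sum n y01.
have : rising n (1 - a) * \sum_(j < n.+1) discrete_ml a y j <= discrete_ml 1 y n.
  have -> : discrete_ml 1 y n = discrete_ml (a + (1 - a)) y n by rewrite subrKC.
  rewrite (discrete_ml_conv _ _ (ltW a0) y01) mulr_sumr.
  apply: ler_sum => j _; rewrite ler_wpM2r ?discrete_ml_resolvent_ge0//.
  by apply: rising_nonincr => //; exact: leq_subr.
move=> /(ler_wpM2l y0); rewrite mulrCA.
have -> : y * \sum_(j < n.+1) discrete_ml a y j = 1 - discrete_ml 1 y n by rewrite h; ring.
lra.
Qed.

End mittag_leffler_bounds.

(** * Passage from the discrete model to the Mittag-Leffler function *)

Section mittag_leffler_limit.
Context {R : realType}.
Variable a : R.
Hypothesis a01 : 0 < a < 1.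
Implicit Types (b s t x y z : R) (n j k : nat).

Let a0 : 0 < a. Proof. by case/andP: a01. Qed.
Let a1 : a < 1. Proof. by case/andP: a01. Qed.
Let a01w : 0 <= a <= 1. Proof. by rewrite !ltW. Qed.

Let term b x n k : R :=
  (- x) ^+ k * (rising n.+1 (k%:R * a + b) * n.+1%:R `^ (1 - (k%:R * a + b))).

Let index_gt0 k b : 0 < b -> 0 < k%:R * a + b.
Proof. by move=> b0; rewrite ltr_wpDl// mulr_ge0// ltW. Qed.

Let powR_index b n k : n.+1%:R `^ (1 - (k.+1%:R * a + b)) =
  n.+1%:R `^ (1 - (k%:R * a + b)) * n.+1%:R `^ (- a) :> R.
Proof.
by rewrite -powRD ?pnatr_eq0 ?implybT//; congr (_ `^ _); rewrite indexS; ring.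
Qed.

Let termE b x n k :
  (- (x * n.+1%:R `^ (- a))) ^+ k * rising n.+1 (k%:R * a + b) * n.+1%:R `^ (1 - b) = term b x n k.
Proof.
rewrite /term -mulNr exprMn -!mulrA; congr (_ * _); rewrite mulrCA; congr (_ * _).
elim: k => [|k IH]; first by rewrite expr0 !mul1r mul0r add0r.
by rewrite powR_index exprSr mulrAC IH.
Qed.

Let scaled b x n : 0 < b -> 0 <= x * n.+1%:R `^ (- a) < 1 ->
  discrete_ml a b (x * n.+1%:R `^ (- a)) n.+1 * n.+1%:R `^ (1 - b) = limn (series (term b x n)).
Proof.
move=> b0 y01; apply/esym; apply: cvg_lim => //.
have h := @discrete_ml_cvg R a a01 _ _ n.+1 (ltW b0) y01.
refine (cvg_trans _ (cvgMr_tmp (b := n.+1%:R `^ (1 - b)) h)).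
apply: near_eq_cvg; apply: nearW => N; rewrite /series/= mulr_suml.
by apply: eq_bigr => k _; rewrite termE.
Qed.

Let term_cvg b x k : 0 < b ->
  term b x n k @[n --> \oo] --> (- x) ^+ k / Gamma (k%:R * a + b).
Proof. by move=> b0; apply: cvgMl_tmp; apply: Gauss_Gamma; exact: index_gt0. Qed.

(** By [rising_ratio] the quotient of consecutive rescaled terms is at most 2 x (1/s + 1/N)^a, with
    N = n + 1. It is below 1/2 once s and N both exceed 2 / e, where e^a = 1 / (4 x + 1); this
    threshold is uniform in n and in the index of the term. *)
Let ratio_small x : 0 <= x -> exists D : R, 1 <= D /\ forall s n, D <= s -> D <= n.+1%:R ->
  x * rising n.+1 (s + a) * n.+1%:R `^ (- a) <= 2^-1 * rising n.+1 s.
Proof.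
move=> x0; pose eta : R := (4 * x + 1)^-1.
have x4 : 0 < 4 * x + 1 by lra.
have eta0 : 0 < eta by rewrite invr_gt0.
pose e := eta `^ a^-1; have e0 : 0 < e by rewrite powR_gt0.
have ea : e `^ a = eta by rewrite /e -powRrM mulVf ?powRr1 ?(ltW eta0)// gt_eqF.
have h3 : 2 * x * eta <= 2^-1 by rewrite /eta ler_pdivrMr//; lra.
clearbody e; clearbody eta.
exists (Num.max 1 (2 / e)); split; first by rewrite le_max lexx.
move=> s n; rewrite !ge_max => /andP[s1 se] /andP[_ ne].
have s0 : 0 < s := lt_le_trans ltr01 s1.
set N := n.+1%:R : R in ne *; have N0 : 0 < N by rewrite ltr0n.
have r0 := rising_gt0 n.+1 s0.
have e2 : N^-1 + s^-1 <= e.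
  have h (z : R) : 0 < z -> 2 / e <= z -> z^-1 <= e / 2.
    by move=> z0 ez; rewrite -[e / 2]invf_div lef_pV2// posrE divr_gt0.
  by rewrite [leRHS]splitr lerD ?h.
have Nsa : (s + N) `^ a * N `^ (- a) = (1 + s / N) `^ a.
  rewrite powRN -powR_div ?addr_ge0 ?(ltW s0) ?(ltW N0)//.
  by congr (_ `^ _); field; rewrite gt_eqF.
have h1 : (s + 1) `^ (1 - a) / s <= 2 * s `^ (- a).
  have -> : s `^ (- a) = s `^ (1 - a) / s.
    rewrite -[X in _ / X]powRr1 ?(ltW s0)// -powRN -powRD ?(gt_eqF s0) ?implybT//.
    by congr (_ `^ _); ring.
  rewrite mulrA ler_pM2r ?invr_gt0//.
  apply: (@le_trans _ _ ((2 * s) `^ (1 - a))).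
    apply: ge0_ler_powR; rewrite ?nnegrE ?subr_ge0 ?(ltW a1)//; lra.
  rewrite powRM ?(ltW s0)// ler_wpM2r ?powR_ge0// ler1_powR ?ler1n//.
  by rewrite lerBlDr lerDl ltW.
have h2 : (1 + s / N) `^ a * s `^ (- a) <= eta.
  rewrite powRN -powR_div ?addr_ge0 ?divr_ge0 ?(ltW s0) ?(ltW N0)//.
  rewrite -ea.
  apply: ge0_ler_powR; rewrite ?(ltW a0) ?nnegrE ?(ltW e0)//.
    by rewrite divr_ge0 ?addr_ge0 ?divr_ge0 ?(ltW s0) ?(ltW N0).
  by apply: le_trans e2; rewrite le_eqVlt; apply/orP; left; apply/eqP; field; rewrite !gt_eqF.
have h4 : x * ((s + N) `^ a * (s + 1) `^ (1 - a) / s) * N `^ (- a) <= 2^-1.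
  apply: le_trans h3.
  have -> : x * ((s + N) `^ a * (s + 1) `^ (1 - a) / s) * N `^ (- a) =
    x * (((s + N) `^ a * N `^ (- a)) * ((s + 1) `^ (1 - a) / s)) by ring.
  rewrite Nsa; apply: (@le_trans _ _ (x * ((1 + s / N) `^ a * (2 * s `^ (- a))))).
    by rewrite ler_wpM2l// ler_wpM2l// powR_ge0.
  have := ler_wpM2l x0 h2; lra.
have h5 := rising_ratio n.+1 a01w s0.
have h6 := ler_wpM2r (powR_ge0 N (- a)) (ler_wpM2l x0 h5).
apply: le_trans h6 _; have := ler_wpM2r (ltW r0) h4; apply: le_trans.
by rewrite le_eqVlt; apply/orP; left; apply/eqP; ring.
Qed.

Let term_dominated b x : 0 < b -> 0 <= x -> exists C : R,
  \forall n \near \oo, forall k, `|term b x n k| <= C * 2^-1 ^+ k.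
Proof.
move=> b0 x0; have [D [D1 Dr]] := ratio_small x0.
(* The finitely many terms below the threshold K are bounded uniformly in n because each of them
   converges as n grows. *)
have /choice[B BP] : forall k, exists M : R, forall n, `|term b x n k| <= M.
  move=> k; have /cvgP/cvg_seq_bounded[M [_ MP]] := @term_cvg b x k b0.
  by exists (M + 1) => n; apply: (MP (M + 1)) => //; rewrite ltrDl.
pose K := (Num.truncn (D / a)).+1.
exists (\sum_(i < K.+1) `|B i| / 2^-1 ^+ i).
near=> n; apply: geometric_dominated_bound => //.
move=> k /(index_large a01 (ltW b0)) Ds.
have Dn : D <= n.+1%:R.
  apply: le_trans (ltW (truncnS_gt D)) _; rewrite ler_nat ltnS; near: n.
  exact: nbhs_infty_ge.
have s0 := index_gt0 k b0.
have := Dr _ _ Ds Dn; rewrite -indexS => h.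
rewrite /term powR_index !normrM !normrX normrN (ger0_norm x0).
rewrite !(gtr0_norm (rising_gt0 _ _)) ?index_gt0//.
rewrite !(ger0_norm (powR_ge0 _ _)).
have := ler_wpM2l (mulr_ge0 (exprn_ge0 k x0) (powR_ge0 n.+1%:R (1 - (k%:R * a + b)))) h.
by rewrite exprS; congr (_ <= _); ring.
Unshelve. all: end_near. Qed.

(** The domination of the discrete terms survives the limit in n, so it also gives the convergence
    of the Mittag-Leffler series; only absolute values enter, hence every real z is covered. *)
Lemma mittag_leffler_dominated b z : 0 < b -> exists C : R,
  forall k, `|z ^+ k / Gamma (k%:R * a + b)| <= C * 2^-1 ^+ k.
Proof.
move=> b0; have [C CP] := term_dominated b0 (normr_ge0 z).
exists C => k.
have -> : `|z ^+ k / Gamma (k%:R * a + b)| = `|(- `|z|) ^+ k / Gamma (k%:R * a + b)|.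
  by rewrite !normrM !normrX normrN normr_id.
apply: (cvgr_to_le (cvg_norm (@term_cvg b `|z| k b0))).
by apply: filterS CP => n; apply.
Qed.

Let step x (n : nat) := x * n.+1%:R `^ (- a).

Let step_small x : 0 <= x -> \forall n \near \oo, 0 <= step x n < 1.
Proof.
move=> x0; near=> n; rewrite /step mulr_ge0 ?powR_ge0//=.
have N0 : 0 < n.+1%:R :> R by rewrite ltr0n.
rewrite powRN -ltr_pdivlMr ?invr_gt0 ?powR_gt0// mul1r invrK.
have xe : x = (x `^ a^-1) `^ a by rewrite -powRrM mulVf ?gt_eqF// powRr1.
rewrite xe; apply: gt0_ltr_powR => //; rewrite ?nnegrE ?powR_ge0//.
apply: lt_le_trans (truncnS_gt _) _; rewrite ler_nat ltnS; near: n.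
exact: nbhs_infty_ge.
Unshelve. all: end_near. Qed.

Lemma mittag_leffler_limit b x : 0 < b -> 0 <= x ->
  discrete_ml a b (x * n.+1%:R `^ (- a)) n.+1 * n.+1%:R `^ (1 - b) @[n --> \oo] -->
  mittag_leffler a b (- x).
Proof.
move=> b0 x0; have [C CP] := term_dominated b0 x0.
have h := Tannery (q := 2^-1) _ (fun k => @term_cvg b x k b0) CP.
refine (cvg_trans _ (h _)); last by lra.
apply: near_eq_cvg; apply: filterS (step_small x0) => n y01.
by apply/esym; apply: scaled.
Qed.

Lemma mittag_leffler_aa_ge0 x : 0 <= x -> 0 <= mittag_leffler a a (- x).
Proof.
move=> x0; apply: (cvgr_to_ge (mittag_leffler_limit a0 x0)).
apply: filterS (step_small x0) => n y01.
by rewrite mulr_ge0 ?powR_ge0 ?discrete_ml_resolvent_ge0.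
Qed.

Let limit1 x : 0 <= x ->
  discrete_ml a 1 (step x n) n.+1 @[n --> \oo] --> mittag_leffler a 1 (- x).
Proof.
move=> x0; refine (cvg_trans _ (mittag_leffler_limit ltr01 x0)).
by apply: near_eq_cvg; apply: nearW => n; rewrite subrr powRr0 mulr1.
Qed.

(** The limit of [discrete_ml_upper] at y = x n^(-a): by Gauss's formula, n^(-a) [rising n (a + 1)]
    tends to 1 / Gamma(a + 1). *)
Lemma mittag_leffler_a1_upper x : 0 <= x ->
  mittag_leffler a 1 (- x) * (1 + x / Gamma (a + 1)) <= 1.
Proof.
move=> x0; have a10 : 0 < a + 1 by rewrite addr_gt0.
have h : discrete_ml a 1 (step x n) n.+1 *
    (1 + x * (rising n.+1 (a + 1) * n.+1%:R `^ (1 - (a + 1)))) @[n --> \oo] -->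
    mittag_leffler a 1 (- x) * (1 + x / Gamma (a + 1)).
  apply: cvgM; first exact: limit1.
  by apply: cvgD; [exact: cvg_cst|apply: cvgMl_tmp; exact: Gauss_Gamma].
apply: (cvgr_to_le h); apply: filterS (step_small x0) => n y01.
have := discrete_ml_upper a01 n.+1 y01; congr (_ * (_ + _) <= _).
by rewrite /step -mulrA; congr (_ * _); rewrite mulrC; congr (_ * _ `^ _); ring.
Qed.

(** [discrete_ml_lower] is multiplied by n^a before passing to the limit, since both y and
    [rising n (1 - a)] decay like n^(-a). *)
Lemma mittag_leffler_a1_lower x : 0 <= x ->
  (Gamma (1 - a))^-1 <= mittag_leffler a 1 (- x) * (x + (Gamma (1 - a))^-1).
Proof.
move=> x0; have oa : 0 < 1 - a by rewrite subr_gt0.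
have g := Gauss_Gamma oa.
have h : discrete_ml a 1 (step x n) n.+1 *
    (x + rising n.+1 (1 - a) * n.+1%:R `^ (1 - (1 - a))) @[n --> \oo] -->
    mittag_leffler a 1 (- x) * (x + (Gamma (1 - a))^-1).
  by apply: cvgM; [exact: limit1|apply: cvgD; [exact: cvg_cst|exact: g]].
apply: (ler_cvg_to g h); apply: filterS (step_small x0) => n y01.
have N0 : 0 < n.+1%:R :> R by rewrite ltr0n.
have := ler_wpM2r (powR_ge0 n.+1%:R a) (discrete_ml_lower a01 n.+1 y01).
have -> : 1 - (1 - a) = a by ring.
move=> /le_trans; apply; rewrite -mulrA mulrDl /step -mulrA -powRD ?(gt_eqF N0) ?implybT//.
by rewrite addNr powRr0 mulr1.
Qed.

Lemma mittag_leffler_a1_gt0 x : 0 <= x -> 0 < mittag_leffler a 1 (- x).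
Proof.
move=> x0; have G0 : 0 < (Gamma (1 - a))^-1 by rewrite invr_gt0 Gamma_gt0 ?subr_gt0.
have := lt_le_trans G0 (mittag_leffler_a1_lower x0).
by rewrite pmulr_lgt0// ltr_wpDl.
Qed.

Lemma mittag_leffler_a1_le1 x : 0 <= x -> mittag_leffler a 1 (- x) <= 1.
Proof.
move=> x0; have G0 : 0 < Gamma (a + 1) by rewrite Gamma_gt0 ?addr_gt0.
apply: le_trans (mittag_leffler_a1_upper x0).
rewrite ler_peMr ?(ltW (mittag_leffler_a1_gt0 x0))// lerDl divr_ge0//.
exact: ltW.
Qed.

End mittag_leffler_limit.

(** * The Duhamel kernel and its integral *)

Section kernel.
Context {R : realType}.
Variable a : R.
Hypothesis a01 : 0 < a < 1.
Implicit Types (b s t x y z L : R) (n j k : nat).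

Let a0 : 0 < a. Proof. by case/andP: a01. Qed.
Let a1 : a < 1. Proof. by case/andP: a01. Qed.

Let coef b k : R := (Gamma (k%:R * a + b))^-1.

Let coef_ge0 b k : 0 < b -> 0 <= coef b k.
Proof.
by move=> b0; rewrite invr_ge0 ltW// Gamma_gt0// ltr_wpDl// mulr_ge0// ltW.
Qed.

Let pseries_coefE b z : pseries (coef b) z = series (fun k => z ^+ k / Gamma (k%:R * a + b)).
Proof. by rewrite /pseries; congr series; apply/funext => k; rewrite mulrC. Qed.

Let coef_dominated b z : 0 < b -> exists C : R, forall k, `|coef b k * z ^+ k| <= C * 2^-1 ^+ k.
Proof.
move=> b0; have [C CP] := mittag_leffler_dominated a01 z b0.
by exists C => k; rewrite mulrC.
Qed.

Let cvg_dominated (c : R^nat) b z w (M : R) : 0 < b -> 0 <= M ->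
  (forall k, `|c k * z ^+ k| <= M * `|coef b k * w ^+ k|) -> cvgn (pseries c z).
Proof.
move=> b0 M0 h; have [C CP] := coef_dominated w b0.
apply: (geometric_dominated_cvg (q := 2^-1) (C := M * C)); first by lra.
by move=> k; apply: le_trans (h k) _; rewrite -mulrA ler_wpM2l.
Qed.

Lemma succ_le_expn k : k.+1%:R <= 2 ^+ k :> R.
Proof. by rewrite -natrX ler_nat ltn_expl. Qed.

Let coef_diffs b k : pseries_diffs (coef b) k = k.+1%:R * coef (b + a) k.
Proof. by rewrite /pseries_diffs /coef indexS addrA. Qed.

(** Each termwise differentiation moves b to b + a and brings out a factor of order k. Since k + 1
    <= 2^k, these factors are absorbed by evaluating the series at 2 K and 4 K. *)
Let is_derive_ml b z : 0 < b -> is_derive z 1 (mittag_leffler a b)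
  (limn (pseries (pseries_diffs (coef b)) z)).
Proof.
move=> b0; pose K := `|z| + 1.
have K0 : 0 <= K by rewrite addr_ge0.
have -> : mittag_leffler a b = fun x => limn (pseries (coef b) x).
  by apply/funext => x; rewrite pseries_coefE.
apply: (@pseries_snd_diffs _ _ K).
- by apply: (@cvg_dominated _ b K K 1) => // k; rewrite mul1r.
- apply: (@cvg_dominated _ (b + a) _ (2 * K) 1) => //; first by rewrite addr_gt0.
  move=> k; have c0 : 0 <= coef (b + a) k by rewrite coef_ge0 ?addr_gt0.
  rewrite coef_diffs mul1r !ger0_norm ?mulr_ge0 ?exprn_ge0 ?mulr_ge0//.
  have := ler_wpM2r (mulr_ge0 c0 (exprn_ge0 k K0)) (succ_le_expn k).
  by rewrite exprMn; congr (_ <= _); ring.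
- apply: (@cvg_dominated _ (b + a + a) _ (4 * K) 2) => //; first by rewrite !addr_gt0.
  move=> k; have c0 : 0 <= coef (b + a + a) k by rewrite coef_ge0 ?addr_gt0.
  have -> : pseries_diffs (pseries_diffs (coef b)) k = k.+1%:R * k.+2%:R * coef (b + a + a) k.
    rewrite /pseries_diffs -/(pseries_diffs (coef b) k.+1) coef_diffs mulrA.
    by congr (_ * _); rewrite /coef indexS -!addrA.
  rewrite !ger0_norm ?mulr_ge0 ?exprn_ge0 ?mulr_ge0//.
  have h : k.+1%:R * k.+2%:R <= 2 * 4 ^+ k :> R.
    have -> : 2 * 4 ^+ k = 2 ^+ k * 2 ^+ k.+1 :> R.
      by rewrite exprS mulrCA -exprMn; congr (_ * _ ^+ _); ring.
    by rewrite ler_pM// succ_le_expn.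
  have := ler_wpM2r (mulr_ge0 c0 (exprn_ge0 k K0)) h.
  by rewrite exprMn; congr (_ <= _); ring.
- by rewrite [ltRHS]ger0_norm// ltrDl.
Qed.

Lemma mittag_leffler_continuous b : 0 < b -> continuous (mittag_leffler a b).
Proof.
move=> b0 z; apply: differentiable_continuous; apply/derivable1_diffP.
exact: (@ex_derive _ _ _ _ _ _ _ (is_derive_ml z b0)).
Qed.

Lemma is_derive_mittag_leffler1 z :
  is_derive z 1 (mittag_leffler a 1) (a^-1 * mittag_leffler a a z).
Proof.
apply: is_derive_eq (is_derive_ml z ltr01) _.
have h : cvgn (pseries (coef a) z) by apply: (@cvg_dominated _ a z z 1) => // k; rewrite mul1r.
apply: cvg_lim => //.
rewrite /mittag_leffler -pseries_coefE.
refine (cvg_trans _ (cvgMl_tmp (a := a^-1) h)).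
apply: near_eq_cvg; apply: nearW => N; rewrite /pseries/series/= mulr_sumr.
apply: eq_bigr => k _.
have ka : 0 < k%:R * a + a by rewrite ltr_wpDl// mulr_ge0// ltW.
have -> : pseries_diffs (coef 1) k = a^-1 * coef a k.
  rewrite coef_diffs /coef (addrC 1) addrA (Gamma_add1 ka) invfM mulrA; congr (_ * _).
  have -> : k%:R * a + a = k.+1%:R * a by rewrite -natr1; ring.
  by rewrite invfM mulrA divff ?mul1r.
by rewrite mulrA.
Qed.

Definition ml_kernel L t s : R :=
  (t - s) `^ (a - 1) * mittag_leffler a a (- L * (t - s) `^ a).

Lemma ml_kernel_ge0 L t s : 0 <= L -> 0 <= ml_kernel L t s.
Proof.
move=> L0; rewrite mulr_ge0 ?powR_ge0// mulNr mittag_leffler_aa_ge0//.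
by rewrite mulr_ge0// powR_ge0.
Qed.

Lemma measurable_ml_kernel L t : measurable_fun [set: R] (ml_kernel L t).
Proof.
have mts : measurable_fun [set: R] (fun s : R => t - s) by apply: measurable_funB.
apply: measurable_funM; first exact: measurableT_comp (measurable_powR _) mts.
apply: measurableT_comp.
  by apply: continuous_measurable_fun; exact: mittag_leffler_continuous.
apply: measurable_funM => //; exact: measurableT_comp (measurable_powR _) mts.
Qed.

Let primitive L t s := L^-1 * mittag_leffler a 1 (- L * (t - s) `^ a).

Let is_derive_primitive L t s : 0 < L -> s < t ->
  is_derive s 1 (primitive L t) (ml_kernel L t s).
Proof.
move=> L0 st; have ts0 : 0 < t - s by rewrite subr_gt0.
have h1 : is_derive s 1 (fun s : R => t - s) (-1).
  have := is_deriveB (is_derive_cst t s (1 : R)) (is_derive_id s (1 : R)).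
  by rewrite sub0r.
have h2 : is_derive s 1 (fun s => (t - s) `^ a) (a * (t - s) `^ (a - 1) * -1).
  exact: (@is_derive1_comp _ (@powR R ^~ a) (fun s => t - s) _ _ _ (is_derive1_powR a ts0) h1).
have h3 : is_derive s 1 (fun s => - L * (t - s) `^ a) (- L * (a * (t - s) `^ (a - 1) * -1)).
  exact: (is_deriveZ (- L) h2).
have h4 := @is_derive1_comp _ (mittag_leffler a 1) _ s _ _ (is_derive_mittag_leffler1 _) h3.
have h5 := is_deriveZ L^-1 h4.
apply: is_derive_eq h5 _; rewrite /ml_kernel.
set M := mittag_leffler a a _; set P := (t - s) `^ (a - 1).
transitivity (L^-1 * (a^-1 * M * (- L * (a * P * -1)))); first by [].
by field; rewrite !gt_eqF.
Qed.

Lemma bigcup_itv_left t : 0 < t ->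
  \bigcup_n [set` `[0, t - t / n.+2%:R]] = [set` `[0, t[] :> set R.
Proof.
move=> t0; apply/seteqP; split => [x [n _] /=|x /=]; rewrite !in_itv/= => /andP[x0 xt].
  rewrite x0 (le_lt_trans xt)// ltrBlDr ltrDl divr_gt0//.
have tx : 0 < t - x by rewrite subr_gt0.
exists (Num.truncn (t / (t - x))) => //=; rewrite in_itv/= x0 lerBrDr -lerBrDl.
rewrite ler_pdivrMr// mulrC -ler_pdivrMr//; apply: le_trans (ltW (truncnS_gt _)) _.
by rewrite ler_nat.
Qed.

(** The kernel has the primitive L^(-1) E_{a,1}(- L (t - s)^a), whose values lie between 0 and
    L^(-1). The singularity at s = t is avoided by integrating up to t - t / (n + 2) and using
    monotone convergence. *)
Lemma integral_ml_kernel_le L t : 0 < L -> 0 < t ->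
  (\int[lebesgue_measure]_(s in `]0%R, t[) (ml_kernel L t s)%:E <= (L^-1)%:E)%E.
Proof.
move=> L0 t0.
have k0 s : (0 <= (ml_kernel L t s)%:E)%E by rewrite lee_fin ml_kernel_ge0// ltW.
have mk (D : set R) : measurable_fun D (fun s => (ml_kernel L t s)%:E).
  by apply/measurable_EFinP; apply: measurable_funTS; exact: measurable_ml_kernel.
rewrite integral_itv_obnd_cbnd// -bigcup_itv_left//.
have ndF : nondecreasing_seq (fun n => [set` `[0, t - t / n.+2%:R]] : set R).
  move=> m n mn; apply/subsetPset => x /=; rewrite !in_itv/= => /andP[-> h]/=.
  apply: le_trans h _; rewrite lerD2l lerN2 ler_pM2l// lef_pV2 ?posrE//.
  by rewrite ler_nat.
have h := @ge0_nondecreasing_set_cvg_integral _ _ _ _ _ lebesgue_measure ndF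
  (fun n => measurable_itv _) (fun n => mk _) (fun n s _ => k0 s).
apply: (cvge_to_le h); apply: nearW => n.
set e := t - t / n.+2%:R.
have et : e < t by rewrite /e ltrBlDr ltrDl divr_gt0.
have e0 : 0 < e by rewrite /e subr_gt0 ltr_pdivrMr// ltr_pMr// ltr1n.
have lt_t s : 0 <= s <= e -> s < t by move=> /andP[_ se]; exact: le_lt_trans et.
rewrite (@continuous_FTC2 _ _ (primitive L t))//.
- rewrite -EFinB lee_fin /primitive -mulrBr ler_piMr ?invr_ge0 ?(ltW L0)//.
  have h1 := mittag_leffler_a1_le1 a01 (x := L * (t - e) `^ a).
  have h2 := mittag_leffler_a1_gt0 a01 (x := L * (t - 0) `^ a).
  rewrite -!mulNr in h1 h2.
  have := h1 (mulr_ge0 (ltW L0) (powR_ge0 _ _)).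
  have := h2 (mulr_ge0 (ltW L0) (powR_ge0 _ _)); lra.
- apply: within_continuousW => s /lt_t st; have ts : 0 < t - s by rewrite subr_gt0.
  have cts : {for s, continuous (fun s : R => t - s)}.
    by apply: cvgB; [exact: cvg_cst|exact: cvg_id].
  have cp b : {for s, continuous (fun s => (t - s) `^ b)}.
    by apply: (@continuous_comp _ _ _ (fun s : R => t - s) (@powR R ^~ b)) => //; exact:
        powR_continuous.
  apply: cvgM; first exact: cp.
  apply: (@continuous_comp _ _ _ (fun s => - L * (t - s) `^ a) (mittag_leffler a a));
      last exact: mittag_leffler_continuous.
  by apply: cvgMl_tmp; exact: cp.
- apply: (derivable_oo_LRcontinuousW e0) => s /lt_t st.
  exact: (@ex_derive _ _ _ _ _ _ _ (is_derive_primitive L0 st)).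
- move=> s; rewrite in_itv/= => /andP[s0 se]; rewrite derive1E.
  have st : s < t by apply: lt_trans et.
  exact: (@derive_val _ _ _ _ _ _ _ (is_derive_primitive L0 st)).
Qed.
End kernel.

(** * The space L2 of the domain *)

Section L2_space.
Context {R : realType} {d : nat} {Om : smooth_domain R d}.
Implicit Types (u v w : L2 Om) (c : R).
Local Notation mu := (dom_measure Om).

Lemma L2_mul_integrable u v : mu.-integrable setT (fun x => (u x * v x)%:E).
Proof.
have := Lfun2_mul_Lfun1 (LfunP u) (LfunP v).
by move/Lfun1_integrable.
Qed.

Lemma L2innerC u v : L2inner u v = L2inner v u.
Proof. by apply: eq_Rintegral => x _; rewrite mulrC. Qed.

Lemma L2innerDl u v w : L2inner (u + v) w = L2inner u w + L2inner v w.
Proof.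
rewrite /L2inner -RintegralD//; [|exact: L2_mul_integrable..].
by apply: eq_Rintegral => x _; rewrite -mulrDl.
Qed.

Lemma L2innerZl c u w : L2inner (c *: u) w = c * L2inner u w.
Proof.
rewrite /L2inner -RintegralZl//; last exact: L2_mul_integrable.
by apply: eq_Rintegral => x _; rewrite mulrA.
Qed.

Lemma L2innerNl u w : L2inner (- u) w = - L2inner u w.
Proof. by rewrite -scaleN1r L2innerZl mulN1r. Qed.

Lemma L2innerBl u v w : L2inner (u - v) w = L2inner u w - L2inner v w.
Proof. by rewrite L2innerDl L2innerNl. Qed.

Lemma L2innerBr u v w : L2inner w (u - v) = L2inner w u - L2inner w v.
Proof. by rewrite !(L2innerC w) L2innerBl. Qed.

Lemma L2innerZr c u w : L2inner w (c *: u) = c * L2inner w u.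
Proof. by rewrite !(L2innerC w) L2innerZl. Qed.

Lemma L2inner0l w : L2inner 0 w = 0.
Proof. by rewrite -(scale0r w) L2innerZl mul0r. Qed.

Lemma L2inner_suml (I : Type) (r : seq I) (P : pred I) (F : I -> L2 Om) w :
  L2inner (\sum_(i <- r | P i) F i) w = \sum_(i <- r | P i) L2inner (F i) w.
Proof.
apply: (big_morph (fun u => L2inner u w)) => [u v|]; first exact: L2innerDl.
exact: L2inner0l.
Qed.

Lemma L2norm_ge0 u : 0 <= L2norm u.
Proof. by rewrite /L2norm fine_ge0// Lnorm_ge0. Qed.

Lemma integral_sqrE u : (\int[mu]_x (u x ^+ 2)%:E = (L2inner u u)%:E)%E.
Proof.
rewrite /L2inner /Rintegral fineK.
  by apply: eq_integral => x _; rewrite expr2.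
by apply: integrable_fin_num => //; exact: L2_mul_integrable.
Qed.

Lemma L2norm_sqr u : L2norm u ^+ 2 = L2inner u u.
Proof.
apply: EFin_inj; rewrite -integral_sqrE -powR_mulrn ?L2norm_ge0// -poweR_EFin.
rewrite (finite_norm_fine u) poweR_Lnorm ?pnatr_eq0//.
apply: eq_integral => x _.
rewrite [LHS](_ : _ = (`|u x| `^ 2)%:E); last by rewrite -poweR_EFin.
by rewrite powR_mulrn// real_normK ?num_real.
Qed.

Lemma L2norm_le u (c : R) : 0 <= c -> (L2norm u <= c) = (L2inner u u <= c ^+ 2).
Proof. by move=> c0; rewrite -L2norm_sqr ler_pXn2r// nnegrE// L2norm_ge0. Qed.

Lemma L2norm_sym u v : L2norm (u - v) = L2norm (v - u).
Proof.
apply/eqP; rewrite -(eqrXn2 (ltn0Sn 1)) ?L2norm_ge0// !L2norm_sqr.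
by rewrite -[v - u]opprB L2innerNl (L2innerC (u - v)) L2innerNl opprK.
Qed.

Lemma L2norm_triangle u v : L2norm (u + v) <= L2norm u + L2norm v.
Proof. exact: ler_LnormD. Qed.

Lemma L2norm_dist u v w : L2norm (u - w) <= L2norm (u - v) + L2norm (v - w).
Proof. by rewrite -(subrKA v) L2norm_triangle. Qed.

Lemma L2_Cauchy_Schwarz u v : `|L2inner u v| <= L2norm u * L2norm v.
Proof.
rewrite -ler_sqr ?nnegrE ?mulr_ge0 ?L2norm_ge0// exprMn !L2norm_sqr real_normK ?num_real//.
have h t : 0 <= L2inner u u - 2 * t * L2inner u v + t ^+ 2 * L2inner v v.
  have := L2norm_sqr (u - t *: v); rewrite L2innerBl !L2innerBr !L2innerZl !L2innerZr.
  rewrite (L2innerC v u) => e; have := sqr_ge0 (L2norm (u - t *: v)).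
  by rewrite e; congr (_ <= _); ring.
have v0 : 0 <= L2inner v v by rewrite -L2norm_sqr sqr_ge0.
have u0 : 0 <= L2inner u u by rewrite -L2norm_sqr sqr_ge0.
move: h v0 u0; move: (L2inner u u) (L2inner u v) (L2inner v v) => A B C h.
rewrite le_eqVlt => /predU1P[C0 A0|C0 A0].
  have [->|B0] := eqVneq B 0; first by rewrite expr0n/= -C0 mulr0.
  (* When C = 0 and B is nonzero, this argument makes the nonnegative polynomial equal to -1. *)
  have := h ((A + 1) / (2 * B)); rewrite -C0 mulr0 addr0.
  have -> : 2 * ((A + 1) / (2 * B)) * B = A + 1 by field.
  lra.
have := mulr_ge0 (ltW C0) (h (B / C)).
have -> : C * (A - 2 * (B / C) * B + (B / C) ^+ 2 * C) = A * C - B ^+ 2 by field; rewrite gt_eqF.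
by rewrite subr_ge0.
Qed.

Lemma L2inner_cvg (u : nat -> L2 Om) v w : L2_cvg u v ->
  L2inner (u n) w @[n --> \oo] --> L2inner v w.
Proof.
move=> uv; apply: cvg_sub0; last exact: (cvg_cst (L2inner v w)).
apply: (@squeeze_cvgr _ _ _ _ (fun n => - (L2norm (u n - v) * L2norm w)) (fun n => L2norm (u n
    - v) * L2norm w)); last 2 first.
- by rewrite -oppr0 -(mul0r (L2norm w)); apply: cvgN; exact: cvgMr_tmp.
- by rewrite -(mul0r (L2norm w)); exact: cvgMr_tmp.
apply: nearW => n; rewrite -ler_norml.
rewrite [X in `|X|](_ : _ = L2inner (u n - v) w); last by rewrite L2innerBl.
exact: L2_Cauchy_Schwarz.
Qed.

End L2_space.

(** * Completeness of L2 by almost everywhere convergence and Fatou's lemma *)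

Section L2_completeness.
Context {R : realType} {d : nat} {Om : smooth_domain R d}.
Implicit Types (u v w : L2 Om) (c : R).
Local Notation mu := (dom_measure Om).

Lemma L2_of_sqr (f : 'rV[R]_d -> R) : measurable_fun setT f ->
  (\int[mu]_x (f x ^+ 2)%:E < +oo)%E -> exists u : L2 Om, forall x, u x = f x.
Proof.
move=> mf foo.
have fL : f \in Lfun mu 2%:E.
  apply/andP; split; first by rewrite inE.
  rewrite inE/=; apply: (@lty_poweRy _ _ 2); first by rewrite pnatr_eq0.
  rewrite poweR_Lnorm ?pnatr_eq0//; apply: le_lt_trans foo.
  rewrite le_eqVlt; apply/orP; left; apply/eqP; apply: eq_integral => x _.
  rewrite [LHS](_ : _ = (`|f x| `^ 2)%:E); last by rewrite -poweR_EFin.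
  by rewrite powR_mulrn// real_normK ?num_real.
by exists (Lfun_Sub (lee1n 2) fL).
Qed.

Lemma measurable_L2 u : measurable_fun setT u.
Proof. exact: measurable_funPT. Qed.

Lemma measurable_sqrB (f g : 'rV[R]_d -> R) : measurable_fun setT f -> measurable_fun setT g ->
  measurable_fun setT (fun x => ((f x - g x) ^+ 2)%:E).
Proof.
by move=> mf mg; apply/measurable_EFinP; apply: measurable_funX; exact: measurable_funB.
Qed.

Lemma measurable_limn_einf (f : nat -> 'rV[R]_d -> \bar R) :
  (forall n, measurable_fun setT (f n)) -> measurable_fun setT (fun x => limn_einf (f ^~ x)).
Proof.
move=> mf; rewrite /limn_einf; apply: measurableT_comp => //.
apply: measurable_fun_limn_esup => n; exact: measurableT_comp.
Qed.

Lemma limn_einf_le (u : (\bar R)^nat) (c : \bar R) : (forall n, (u n <= c)%E) -> (limn_einf u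
    <= c)%E.
Proof.
move=> uc; apply: le_trans (limn_einf_sup _) _; rewrite limn_esup_lim.
apply: lime_le; first exact: is_cvg_esups.
by apply: nearW => n; apply: ge_ereal_sup => _ [m _ <-].
Qed.

Lemma limn_einf_ge0 (u : (\bar R)^nat) : (forall n, (0 <= u n)%E) -> (0 <= limn_einf u)%E.
Proof.
move=> u0; rewrite limn_einf_lim; apply: lime_ge; first exact: is_cvg_einfs.
by apply: nearW => n; apply: le_ereal_inf_tmp => _ [m _ <-].
Qed.

Section fast.
Variable w : nat -> L2 Om.
Hypothesis w_fast : forall k, L2inner (w k.+1 - w k) (w k.+1 - w k) <= 8^-1 ^+ k.

(* Where the sum of the [G k] is finite, [w k] converges geometrically. *)
Let G k x := (4 ^+ k * (w k.+1 x - w k x) ^+ 2)%:E.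

Let G_ge0 k x : (0 <= G k x)%E.
Proof. by rewrite lee_fin; apply: mulr_ge0; [exact: exprn_ge0|exact: sqr_ge0]. Qed.

Let mG k : measurable_fun setT (G k).
Proof.
apply/measurable_EFinP; apply: measurable_funM => //; apply: measurable_funX.
by apply: measurable_funB; exact: measurable_L2.
Qed.

Let int_G : (\int[mu]_x (\sum_(k <oo) G k x) <= 2%:E)%E.
Proof.
rewrite integral_nneseries//.
apply: lime_le; first by apply: is_cvg_nneseries => n _ _; apply: integral_ge0 => x _; exact: G_ge0.
apply: nearW => n.
apply: (@le_trans _ _ (\sum_(0 <= k < n) (2^-1 ^+ k)%:E)%E).
  apply: lee_sum => k _.
  have -> : (\int[mu]_x G k x = (4 ^+ k * L2inner (w k.+1 - w k) (w k.+1 - w k))%:E)%E.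
    rewrite EFinM -integral_sqrE -ge0_integralZl_EFin//.
    - by move=> x _; rewrite lee_fin sqr_ge0.
    - by apply: (@measurable_sqrB (w k.+1) (w k)); exact: measurable_L2.
  rewrite lee_fin; apply: le_trans (ler_wpM2l _ (w_fast k)) _; first by rewrite exprn_ge0.
  by rewrite -exprMn le_eqVlt; apply/orP; left; apply/eqP; congr (_ ^+ _); field.
rewrite sumEFin lee_fin.
have q1 : `|2^-1 : R| < 1 by rewrite ger0_norm; lra.
have q0 : 0 < 2^-1 :> R by lra.
have -> : \sum_(0 <= k < n) 2^-1 ^+ k = series (geometric 1 2^-1) n :> R.
  by rewrite /series/=; apply: eq_bigr => k _; rewrite mul1r.
apply: le_trans (geometric_le_lim n ler01 q0 q1) _.
by rewrite le_eqVlt; apply/orP; left; apply/eqP; field.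
Qed.

(** The upper limit is measurable on the whole space, and equals the pointwise limit wherever that
    exists. *)
Let v0 x := fine (limn_esup (fun k => (w k x)%:E)).

Let mv0 : measurable_fun setT v0.
Proof.
apply: measurableT_comp => //; apply: measurable_fun_limn_esup => n.
by apply/measurable_EFinP; exact: measurable_L2.
Qed.

Let w_cvg : {ae mu, forall x, w k x @[k --> \oo] --> v0 x}.
Proof.
have iG : mu.-integrable setT (fun x => \sum_(k <oo) G k x)%E.
  apply/integrableP; split.
    by apply: ge0_emeasurable_sum => // k x _ _; exact: G_ge0.
  apply: le_lt_trans (ltry 2); apply: le_trans int_G.
  rewrite le_eqVlt; apply/orP; left; apply/eqP; apply: eq_integral => x _.
  by rewrite gee0_abs// nneseries_ge0.
have := integrable_ae measurableT iG; apply: filterS => x /(_ I) Gfin.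
pose M := fine (\sum_(k <oo) G k x)%E.
have GM k : 4 ^+ k * (w k.+1 x - w k x) ^+ 2 <= M.
  rewrite -lee_fin fineK//; apply: le_trans (nneseries_lim_ge k.+1 _); last by [].
  rewrite big_nat_recr//= leeDr// sume_ge0// => i _; exact: G_ge0.
have M0 : 0 <= M by apply: le_trans (GM 0%N); rewrite mulr_ge0 ?sqr_ge0.
(* The inequality M <= (1 + M)^2 saves a square root. *)
have D k : `|w k.+1 x - w k x| <= (1 + M) * 2^-1 ^+ k.
  rewrite -ler_sqr ?nnegrE ?mulr_ge0 ?addr_ge0 ?exprn_ge0//.
  rewrite real_normK ?num_real// exprMn exprAC.
  have -> : (2^-1 ^+ 2) ^+ k = (4 ^+ k)^-1 :> R by rewrite -exprVn; congr (_ ^+ _); field.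
  rewrite ler_pdivlMr ?exprn_gt0// mulrC; apply: le_trans (GM k) _; nra.
have q01 : 0 < (2^-1 : R) < 1 by lra.
have /cvg_ex[l hl] := geometric_dominated_cvg q01 D.
have wl : w k x @[k --> \oo] --> w 0%N x + l.
  refine (cvg_trans _ (cvgD (cvg_cst (w 0%N x)) hl)).
  apply: near_eq_cvg; apply: nearW => n.
  transitivity (w 0%N x + \sum_(0 <= k < n) (w k.+1 x - w k x)); first by [].
  have -> : \sum_(0 <= k < n) (w k.+1 x - w k x) = w n x - w 0%N x.
    exact: (telescope_sumr (fun k => w k x) (leq0n n)).
  by rewrite addrC subrK.
suff -> : v0 x = w 0%N x + l by [].
rewrite /v0 is_cvg_limn_esupE; last by apply/cvg_ex; exists (w 0%N x + l)%:E; apply: cvg_EFin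
    => //; exact: nearW.
by rewrite (cvg_lim _ (cvg_EFin _ wl))//; exact: nearW.
Qed.

(** Fatou's lemma: the integrand is almost everywhere the lower limit of the squares of w_(k+j) -
    w_j, whose integrals are bounded by c. *)
Let v0_le j c : (forall k, L2inner (w (k + j)%N - w j) (w (k + j)%N - w j) <= c) ->
  (\int[mu]_x ((v0 x - w j x) ^+ 2)%:E <= c%:E)%E.
Proof.
move=> wc; pose f k x := ((w (k + j)%N x - w j x) ^+ 2)%:E.
have mf k : measurable_fun setT (f k).
  by apply: (@measurable_sqrB (w (k + j)%N) (w j)); exact: measurable_L2.
have f0 k x : (0 <= f k x)%E by rewrite lee_fin sqr_ge0.
apply: (@le_trans _ _ (\int[mu]_x limn_einf (f ^~ x))%E).
  apply: ae_ge0_le_integral => //.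
  - by move=> x _; rewrite lee_fin sqr_ge0.
  - by apply: measurable_sqrB => //; exact: measurable_L2.
  - by move=> x _; apply: limn_einf_ge0 => n; exact: f0.
  - exact: measurable_limn_einf.
  apply: filterS w_cvg => x wx _.
  have fx : f k x @[k --> \oo] --> ((v0 x - w j x) ^+ 2)%:E.
    apply: cvg_EFin; first exact: nearW.
    have h : w (k + j)%N x - w j x @[k --> \oo] --> v0 x - w j x.
      by apply: cvgB; [rewrite (cvg_shiftn j (fun k => w k x))|exact: cvg_cst].
    exact: (cvgM h h).
  by have [-> _] := cvg_limn_einf_sup fx.
apply: le_trans (fatou _ _ _ _) _ => //.
apply: limn_einf_le => n.
have -> : (\int[mu]_x f n x = (L2inner (w (n + j)%N - w j) (w (n + j)%N - w j))%:E)%E.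
  by rewrite -integral_sqrE.
by rewrite lee_fin.
Qed.

Lemma L2_fast_cvg : (exists c : R, forall k, L2inner (w k - w 0%N) (w k - w 0%N) <= c) ->
  exists v : L2 Om, forall j (c : R),
    (forall k, L2inner (w (k + j)%N - w j) (w (k + j)%N - w j) <= c) ->
    L2inner (v - w j) (v - w j) <= c.
Proof.
move=> [c0 wc0].
have h0 : (\int[mu]_x ((v0 x - w 0%N x) ^+ 2)%:E < +oo)%E.
  apply: le_lt_trans (ltry c0); apply: v0_le => k.
  by rewrite addn0.
(* Only the difference v0 - w_0 is directly known to be square integrable; the limit is then
   obtained by adding w_0 back. *)
have [r rE] := L2_of_sqr (measurable_funB mv0 (measurable_L2 (w 0%N))) h0.
exists (r + w 0%N) => j c wc; rewrite -lee_fin -integral_sqrE.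
apply: le_trans (v0_le wc); rewrite le_eqVlt; apply/orP; left; apply/eqP.
apply: eq_integral => x _; congr (EFin (_ ^+ 2)).
by transitivity (r x + w 0%N x - w j x); [by []|rewrite rE /= subrK].
Qed.
End fast.

Lemma L2_complete (u : nat -> L2 Om) :
  (forall e : R, 0 < e -> exists N, forall m n, (N <= m)%N -> (N <= n)%N -> L2norm (u m - u n)
      <= e) ->
  exists v, L2_cvg u v.
Proof.
move=> uC; pose e k : R := 8^-1 ^+ k.
have e0 k : 0 < e k by rewrite exprn_gt0//; lra.
have /choice[N0 N0P] := fun k => uC _ (e0 k).
(* Summing the thresholds makes them nondecreasing while keeping N k >= N0 k. *)
pose N k := (\sum_(i < k.+1) N0 i)%N.
have N0N k : (N0 k <= N k)%N by rewrite /N big_ord_recr/= leq_addl.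
have Nmono i j : (i <= j)%N -> (N i <= N j)%N.
  move=> ij; rewrite -(subnKC ij); elim: (j - i)%N => [|n IH]; first by rewrite addn0.
  by apply: leq_trans IH _; rewrite addnS /N [X in (_ <= X)%N]big_ord_recr/= leq_addr.
have NP k m n : (N k <= m)%N -> (N k <= n)%N -> L2norm (u m - u n) <= e k.
  by move=> km kn; apply: N0P; exact: leq_trans (N0N k) _.
have e1 k : e k <= 1 by rewrite exprn_ile1//; lra.
have sqr_e k m n : (N k <= m)%N -> (N k <= n)%N -> L2inner (u m - u n) (u m - u n) <= e k ^+ 2.
  by move=> km kn; rewrite -L2norm_le ?NP// ltW.
have fast k : L2inner (u (N k.+1) - u (N k)) (u (N k.+1) - u (N k)) <= 8^-1 ^+ k.
  apply: le_trans (sqr_e k _ _ (Nmono _ _ (leqnSn k)) (leqnn _)) _.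
  by rewrite expr2 ler_piMr// ltW.
have [|v vP] := @L2_fast_cvg (fun k => u (N k)) fast.
  by exists (e 0%N ^+ 2) => k; apply: sqr_e => //; exact: Nmono.
exists v; apply/cvgrPdist_le => eps eps0.
have e_cvg : e k @[k --> \oo] --> 0.
  have := @cvg_geometric R 1 8^-1; rewrite ger0_norm; last by lra.
  move=> h; refine (cvg_trans _ (h _)); last by lra.
  by apply: near_eq_cvg; apply: nearW => n /=; rewrite mul1r.
have /cvgrPdist_le/(_ _ (divr_gt0 eps0 (ltr0n _ 2)))[K _ /(_ K (leqnn K))] := e_cvg.
rewrite sub0r normrN (gtr0_norm (e0 K)) => eK.
exists (N K) => // n /= Kn; rewrite sub0r normrN ger0_norm ?L2norm_ge0//.
apply: le_trans (L2norm_dist _ (u (N K)) _) _; rewrite [leRHS]splitr.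
apply: lerD; first by apply: le_trans eK; apply: NP.
apply: le_trans eK; rewrite L2norm_sym L2norm_le ?(ltW (e0 K))//.
by apply: vP => k; apply: sqr_e => //; apply: Nmono; exact: leq_addl.
Qed.

End L2_completeness.

(** * Expansions in an orthonormal basis *)

Section L2_basis.
Context {R : realType} {d : nat} {Om : smooth_domain R d}.
Variable phi : nat -> L2 Om.
Hypothesis onb : L2_orthonormal_basis phi.
Implicit Types (u v w : L2 Om) (c : R^nat).

Lemma L2inner_partial_sum c N n :
  L2inner (\sum_(i < N) c i *: phi i) (phi n) = if (n < N)%N then c n else 0.
Proof.
have [on _] := onb; rewrite L2inner_suml.
under eq_bigr do rewrite L2innerZl on.
case: ifPn => nN.
  rewrite (bigD1 (Ordinal nN))//= eqxx mulr1 big1 ?addr0// => i /negbTE.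
  by rewrite -val_eqE/= => ->; rewrite mulr0.
by apply: big1 => i _; case: eqP => [e|_]; rewrite ?mulr0//; move: nN; rewrite -e ltn_ord.
Qed.

Lemma L2inner_basis_sum c w N :
  L2inner w (\sum_(i < N) c i *: phi i) = \sum_(i < N) c i * L2inner w (phi i).
Proof.
by rewrite L2innerC L2inner_suml; apply: eq_bigr => i _; rewrite L2innerZl L2innerC.
Qed.

Lemma L2norm_partial_sum c N :
  L2norm (\sum_(i < N) c i *: phi i) ^+ 2 = \sum_(i < N) c i ^+ 2.
Proof.
rewrite L2norm_sqr L2inner_basis_sum; apply: eq_bigr => i _.
by rewrite L2inner_partial_sum ltn_ord expr2.
Qed.

Lemma L2norm_sub_partial_sum w N :
  L2norm (w - \sum_(i < N) L2inner w (phi i) *: phi i) ^+ 2 =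
  L2norm w ^+ 2 - \sum_(i < N) L2inner w (phi i) ^+ 2.
Proof.
have h := L2norm_partial_sum (fun i => L2inner w (phi i)) N; rewrite L2norm_sqr in h.
have e := L2inner_basis_sum (fun i => L2inner w (phi i)) w N.
rewrite !L2norm_sqr L2innerBl !L2innerBr h (L2innerC (\sum_(i < N) _) w) e.
by under eq_bigr do rewrite -expr2; ring.
Qed.

Lemma Parseval w : \sum_(i < N) L2inner w (phi i) ^+ 2 @[N --> \oo] --> L2norm w ^+ 2.
Proof.
have [_ bs] := onb; have h := bs w.
have e0 : L2norm w ^+ 2 - 0 * 0 = L2norm w ^+ 2 by rewrite mul0r subr0.
rewrite -[X in _ --> X]e0.
have h2 : L2norm (\sum_(n < N) L2inner w (phi n) *: phi n - w) ^+ 2 @[N --> \oo] --> (0 * 0 : R).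
  exact: (cvgM h h).
refine (cvg_trans _ (cvgB (cvg_cst (L2norm w ^+ 2)) h2)).
apply: near_eq_cvg; apply: nearW => N.
transitivity (L2norm w ^+ 2 - L2norm (\sum_(n < N) L2inner w (phi n) *: phi n - w) ^+ 2); first
    by [].
by rewrite L2norm_sym L2norm_sub_partial_sum subKr.
Qed.

Lemma Bessel w N : \sum_(i < N) L2inner w (phi i) ^+ 2 <= L2norm w ^+ 2.
Proof. by rewrite -subr_ge0 -L2norm_sub_partial_sum sqr_ge0. Qed.

Lemma Parseval_le w (B : R) : (forall N, \sum_(i < N) L2inner w (phi i) ^+ 2 <= B) ->
  L2norm w ^+ 2 <= B.
Proof. by move=> h; apply: (cvgr_to_le (@Parseval w)); apply: nearW => N; exact: h. Qed.

(** Rules out the default value of [L2_series]: bounded sums of squares are nondecreasing, hence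
    convergent, and their increments are the squared distances between partial sums. *)
Lemma Riesz_Fischer c (B : R) : (forall N, \sum_(i < N) c i ^+ 2 <= B) ->
  L2_cvg (fun N => \sum_(i < N) c i *: phi i) (L2_series (fun n => c n *: phi n)).
Proof.
move=> cB; pose S N := \sum_(i < N) c i *: phi i; pose s N := \sum_(i < N) c i ^+ 2.
have SD m n : (m <= n)%N -> L2norm (S n - S m) ^+ 2 = s n - s m.
  (* S m is the projection of S n onto the first m modes, so the Pythagorean identity
     [L2norm_sub_partial_sum] applies. *)
  move=> mn; have -> : S n - S m = S n - \sum_(i < m) L2inner (S n) (phi i) *: phi i.
    congr (_ - _); apply: eq_bigr => i _.
    by rewrite L2inner_partial_sum (leq_trans (ltn_ord i) mn).
  rewrite L2norm_sub_partial_sum L2norm_partial_sum; congr (_ - _).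
  by apply: eq_bigr => i _; rewrite L2inner_partial_sum (leq_trans (ltn_ord i) mn).
have s_nd : nondecreasing_seq s.
  by apply/nondecreasing_seqP => n; rewrite /s big_ord_recr/= lerDl sqr_ge0.
have /cvg_ex[l sl] : cvgn s.
  apply: nondecreasing_is_cvgn => //; exists B => _ [n _ <-]; exact: cB.
have [v Sv] : exists v, L2_cvg S v.
  apply: L2_complete => e e0.
  have e20 : 0 < e ^+ 2 / 2 by rewrite divr_gt0// exprn_gt0.
  have /cvgrPdist_le/(_ _ e20)[N _ NP] := sl; exists N.
  suff h m n : (N <= m)%N -> (m <= n)%N -> L2norm (S n - S m) <= e.
    move=> m n Nm Nn; have [mn|/ltnW nm] := leqP m n; last exact: h.
    by rewrite L2norm_sym; exact: h.
  move=> Nm mn; rewrite -ler_sqr ?nnegrE ?L2norm_ge0 ?(ltW e0)// SD//.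
  have := NP _ Nm; have := NP _ (leq_trans Nm mn); rewrite /= !ler_norml => /andP[h1 _] /andP[_ h2].
  lra.
rewrite /L2_series; apply: (@xgetPex _ 0 [set v | L2_cvg (fun N => \sum_(n < N) c n *: phi n) v]).
by exists v.
Qed.

Lemma L2inner_series c (B : R) n : (forall N, \sum_(i < N) c i ^+ 2 <= B) ->
  L2inner (L2_series (fun n => c n *: phi n)) (phi n) = c n.
Proof.
move=> cB; have h := L2inner_cvg (w := phi n) (Riesz_Fischer cB).
apply/esym; apply: (cvg_unique _ _ h) => //.
refine (cvg_trans _ (cvg_cst (c n))); apply: near_eq_cvg; exists n.+1 => // N /= nN.
by rewrite L2inner_partial_sum nN.
Qed.

End L2_basis.

(** * The Duhamel terms *)

(* Unlike in the library, the integrands need not be measurable: the integral is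
   a supremum over simple functions, which can be put to 0 on a null set. *)
Section ae_integral.
Context d (T : measurableType d) (R : realType) (mu : {measure set T -> \bar R}).
Implicit Types (f g : T -> \bar R) (D : set T).
Import HBNNSimple.

Lemma ae_ge0_le_integralT f g : (forall x, 0 <= f x)%E -> (forall x, 0 <= g x)%E ->
  {ae mu, forall x, (f x <= g x)%E} -> (\int[mu]_x f x <= \int[mu]_x g x)%E.
Proof.
move=> f0 g0 [N [mN N0 fgN]].
rewrite !ge0_integralTE//; apply: ge_ereal_sup => _ [h /= hf <-].
pose h' := proj_nnsfun h (measurableC mN).
have h'E x : h' x = if x \in N then 0 else h x.
  rewrite /h' -[LHS]/((proj_nnsfun h (measurableC mN) : T -> R) x) -mrestrict patchE.
  by rewrite in_setC; case: (x \in N).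
apply: le_ereal_sup_tmp; exists (sintegral mu h').
  exists h' => // x; rewrite h'E; case: ifPn => xN; first exact: g0.
  apply: le_trans (hf x) _; apply: contrapT => fg; move/negP: xN; apply.
  by rewrite inE; apply: fgN.
rewrite -!integralT_nnsfun; apply: ae_ge0_le_integral => //.
- by move=> x _; rewrite lee_fin; exact: fun_ge0.
- by apply/measurable_EFinP; exact: measurable_funPT.
- by move=> x _; rewrite lee_fin; exact: fun_ge0.
- by apply/measurable_EFinP; exact: measurable_funPT.
exists N; split => // x hx; apply: contrapT => xN.
by apply: hx => _; rewrite h'E memNset.
Qed.

Lemma ae_eq_integral_any D f g : {ae mu, forall x, D x -> f x = g x} ->
  (\int[mu]_(x in D) f x = \int[mu]_(x in D) g x)%E.
Proof.
have ge0 (f1 g1 : T -> \bar R) : (forall x, 0 <= f1 x)%E -> (forall x, 0 <= g1 x)%E ->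
    {ae mu, forall x, D x -> f1 x = g1 x} -> (\int[mu]_(x in D) f1 x = \int[mu]_(x in D) g1 x)%E.
  move=> f0 g0 fg; rewrite integral_mkcond [RHS]integral_mkcond.
  apply/eqP; rewrite eq_le; apply/andP; split; apply: ae_ge0_le_integralT;
    try by move=> x; apply: erestrict_ge0.
  - apply: filterS fg => x fg; rewrite !patchE.
    by case: ifPn => // /set_mem /fg ->.
  - apply: filterS fg => x fg; rewrite !patchE.
    by case: ifPn => // /set_mem /fg ->.
move=> fg; rewrite integralE [RHS]integralE; congr (_ - _)%E; apply: ge0 => //.
- by apply: filterS fg => x fg Dx; rewrite !funeposE fg.
- by apply: filterS fg => x fg Dx; rewrite !funenegE fg.
Qed.

End ae_integral.

(** * Time integrals of the modes of an essentially bounded source *)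

Section time_integrals.
Context {R : realType} {d : nat} {Om : smooth_domain R d}.
Variables (a tau : R) (phi : L2 Om).
Hypotheses (a01 : 0 < a < 1) (tau0 : 0 < tau) (phi1 : L2norm phi = 1).
Implicit Types (f g : R -> L2 Om).
Let leb : {measure set (measurableTypeR R) -> \bar R} := lebesgue_measure.
Let leb_filter : Filter (nbhs (almost_everywhere leb)).
Proof. exact: ae_filter_ringOfSetsType. Qed.

Let aeS (P Q : R -> Prop) : (forall s, P s -> Q s) ->
  {ae leb, forall s, P s} -> {ae leb, forall s, Q s}.
Proof. move=> PQ h; exact: (@filterS _ (almost_everywhere leb) leb_filter _ _ PQ h). Qed.

Let aeS2 (P Q S : R -> Prop) : (forall s, P s -> Q s -> S s) ->
  {ae leb, forall s, P s} -> {ae leb, forall s, Q s} -> {ae leb, forall s, S s}.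
Proof. move=> PQ h k; exact: (@filterS2 _ (almost_everywhere leb) leb_filter _ _ _ PQ h k). Qed.

Local Notation I := (`]0%R, tau[%classic : set R).

Lemma time_ae (P : R -> Prop) : {ae time_measure tau, forall s, P s} ->
  {ae leb, forall s, I s -> P s}.
Proof.
move=> [N [mN N0 PN]]; exists (N `&` I); split => //.
- by apply: measurableI => //; exact: measurable_itv.
- by move=> s /= /not_implyP[Is nP]; split => //; apply: PN.
Qed.

(** The L^oo norm is an essential supremum when the total measure is positive; here this rests on
    tau > 0. *)
Lemma time_measure_gt0 : (0 < time_measure tau [set: R])%E.
Proof.
rewrite /= /mrestr setTI lebesgue_measure_itv/= lte_fin tau0.
by rewrite sube0 lte_fin.
Qed.

Lemma ess_normE f : ess_norm tau f =
  ess_sup (time_measure tau) (fun s => (L2norm (f s))%:E).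
Proof.
rewrite /ess_norm unlock time_measure_gt0; congr ess_sup.
by apply/funext => s; rewrite /= ger0_norm// L2norm_ge0.
Qed.

Lemma ess_norm_ge0 f : (0 <= ess_norm tau f)%E.
Proof.
rewrite ess_normE ess_sup_gee ?time_measure_gt0//.
by apply: aeW => s; rewrite lee_fin L2norm_ge0.
Qed.

Lemma ess_norm_fineK f : (ess_norm tau f < +oo)%E -> (Linfty_norm tau f)%:E = ess_norm tau f.
Proof. by move=> foo; rewrite /Linfty_norm fineK// ge0_fin_numE// ess_norm_ge0. Qed.

Lemma Linfty_norm_ge0 f : 0 <= Linfty_norm tau f.
Proof. by rewrite /Linfty_norm fine_ge0// ess_norm_ge0. Qed.

Lemma ess_norm_ae f : (ess_norm tau f < +oo)%E ->
  {ae leb, forall s, I s -> L2norm (f s) <= Linfty_norm tau f}.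
Proof.
move=> foo; apply: time_ae; have := ess_sup_ge (time_measure tau) (fun s => (L2norm (f s))%:E).
by rewrite -ess_normE -ess_norm_fineK//; apply: filterS => s; rewrite lee_fin.
Qed.

Lemma ess_normB_lty f g : (ess_norm tau f < +oo)%E -> (ess_norm tau g < +oo)%E ->
  (ess_norm tau (fun s => (f s - g s)%R) < +oo)%E.
Proof.
move=> foo goo; rewrite ess_normE.
apply: (@le_lt_trans _ _ (Linfty_norm tau f + Linfty_norm tau g)%:E); last exact: ltry.
apply/ess_supP.
have hf := ess_sup_ge (time_measure tau) (fun s => (L2norm (f s))%:E).
have hg := ess_sup_ge (time_measure tau) (fun s => (L2norm (g s))%:E).
rewrite -ess_normE -ess_norm_fineK// in hf; rewrite -ess_normE -ess_norm_fineK// in hg.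
apply: filterS2 hf hg => s; rewrite !lee_fin => hf hg.
apply: le_trans (L2norm_triangle _ _) _; apply: lerD => //.
by have := L2norm_sym 0 (g s); rewrite sub0r subr0 => ->.
Qed.

(** Strong measurability holds up to a null set, so the pairing with [phi] is only almost everywhere
    equal to a measurable function, namely the upper limit of the pairings of the simple
    functions. *)
Lemma L2inner_ae_measurable f : strongly_measurable tau f ->
  exists F : R -> R, measurable_fun setT F /\
    {ae leb, forall s, I s -> L2inner (f s) phi = F s}.
Proof.
move=> [m [A [v [mA ae_cvg]]]].
pose Fk k s : R := \sum_(i < m k) \1_(A k i) s * L2inner (v k i) phi.
exists (fun s => fine (limn_esup (fun k => (Fk k s)%:E))); split.
  apply: measurableT_comp => //; apply: measurable_fun_limn_esup => k.
  apply/measurable_EFinP; apply: measurable_sum => i.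
  by apply: measurable_funM; [apply: measurable_indic; exact: mA|exact: measurable_cst].
apply: time_ae; apply: filterS ae_cvg => s /(L2inner_cvg (w := phi)) h.
have {}h : Fk k s @[k --> \oo] --> L2inner (f s) phi.
  refine (cvg_trans _ h); apply: near_eq_cvg; apply: nearW => k.
  by rewrite L2inner_suml; apply: eq_bigr => i _; rewrite L2innerZl.
rewrite is_cvg_limn_esupE; last by apply/cvg_ex; exists (L2inner (f s) phi)%:E; apply: cvg_EFin
    => //; exact: nearW.
by rewrite (cvg_lim _ (cvg_EFin _ h))//; exact: nearW.
Qed.

Lemma L2inner_ae_bound f : (ess_norm tau f < +oo)%E ->
  {ae leb, forall s, I s -> `|L2inner (f s) phi| <= Linfty_norm tau f}.
Proof.
move=> foo; apply: aeS (ess_norm_ae foo) => s h Is.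
by apply: le_trans (L2_Cauchy_Schwarz _ _) _; rewrite phi1 mulr1 h.
Qed.

Section kernel_integrals.
Variable L : R.
Hypothesis L0 : 0 < L.
Local Notation k := (ml_kernel a L tau).

Lemma kernel_bounded (F : R -> R) (M : R) : measurable_fun setT F -> 0 <= M ->
  {ae leb, forall s, I s -> `|F s| <= M} ->
  leb.-integrable I (fun s => (k s * F s)%:E) /\
  `|\int[leb]_(s in I) (k s * F s)| <= M / L.
Proof.
move=> mF M0 FM.
have k0 s : 0 <= k s by rewrite ml_kernel_ge0// ltW.
have mk := measurable_ml_kernel a01 L tau.
have mkF : measurable_fun I (fun s => k s * F s).
  by apply: measurable_funTS; apply: measurable_funM.
have bnd : (\int[leb]_(s in I) (`|k s * F s|)%:E <= (M / L)%:E)%E.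
  apply: (@le_trans _ _ (\int[leb]_(s in I) (M%:E * (k s)%:E))%E).
    apply: ae_ge0_le_integral => //.
    - by apply/measurable_EFinP; exact: measurableT_comp.
    - by move=> s _; rewrite mule_ge0// lee_fin.
    - apply: measurable_funeM; apply/measurable_EFinP; exact: measurable_funTS.
    apply: aeS FM => s h Is; rewrite -EFinM lee_fin normrM (ger0_norm (k0 s)) mulrC.
    by rewrite ler_wpM2r// h.
  rewrite ge0_integralZl_EFin//; last 2 first.
  - by move=> s _; rewrite lee_fin.
  - by apply/measurable_EFinP; exact: measurable_funTS.
  rewrite EFinM; apply: lee_wpmul2l; first by rewrite lee_fin.
  exact: integral_ml_kernel_le.
have ikF : leb.-integrable I (fun s => (k s * F s)%:E).
  apply/integrableP; split; first exact/measurable_EFinP.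
  exact: le_lt_trans bnd (ltry _).
split; first exact: ikF.
have mI : measurable (I : set (measurableTypeR R)) by exact: measurable_itv.
have h := @le_normr_Rintegral _ (measurableTypeR R) R leb I (fun s => k s * F s) mI ikF.
apply: le_trans h _.
rewrite -lee_fin; refine (le_trans _ bnd); rewrite /Rintegral fineK//.
rewrite ge0_fin_numE; first by have := le_lt_trans bnd (ltry _); exact.
by apply: integral_ge0 => s _; rewrite lee_fin.
Qed.

(** Subtracting the integrals requires integrability, so the two pairings are first replaced by
    their measurable representatives F and G. *)
Lemma kernel_integral_diff f g : Linfty_L2 tau f -> Linfty_L2 tau g ->
  `|\int[leb]_(s in I) (k s * L2inner (f s) phi) - \int[leb]_(s in I) (k s * L2inner (g s) phi)|
  <= Linfty_norm tau (fun s => f s - g s) / L.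
Proof.
move=> [smf foo] [smg goo].
have [F [mF Ff]] := L2inner_ae_measurable smf.
have [G [mG Gg]] := L2inner_ae_measurable smg.
have FM : {ae leb, forall s, I s -> `|F s| <= Linfty_norm tau f}.
  by apply: aeS2 Ff (L2inner_ae_bound foo) => s e h Is; rewrite -e// h.
have [iF _] := kernel_bounded mF (Linfty_norm_ge0 f) FM.
have GM : {ae leb, forall s, I s -> `|G s| <= Linfty_norm tau g}.
  by apply: aeS2 Gg (L2inner_ae_bound goo) => s e h Is; rewrite -e// h.
have [iG _] := kernel_bounded mG (Linfty_norm_ge0 g) GM.
have fgoo := ess_normB_lty foo goo.
have FG : {ae leb, forall s, (I s -> L2inner (f s) phi = F s) /\ (I s -> L2inner (g s) phi = G s)}.
  by apply: aeS2 Ff Gg => s; split.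
have FGM : {ae leb, forall s, I s -> `|F s - G s| <= Linfty_norm tau (fun s => f s - g s)}.
  apply: aeS2 FG (L2inner_ae_bound fgoo) => s [e1 e2] h Is.
  by rewrite -e1// -e2// -L2innerBl h.
have [_ h] := kernel_bounded (measurable_funB mF mG) (Linfty_norm_ge0 (fun s => f s - g s)) FGM.
have eqR u U : {ae leb, forall s, I s -> L2inner (u s) phi = U s} ->
  \int[leb]_(s in I) (k s * L2inner (u s) phi) = \int[leb]_(s in I) (k s * U s).
  move=> e; congr fine; apply: ae_eq_integral_any.
  by apply: aeS e => s e Is; rewrite e.
rewrite (eqR _ _ Ff) (eqR _ _ Gg) -RintegralB//.
apply: le_trans h; rewrite le_eqVlt; apply/orP; left; apply/eqP; congr `|_|.
by apply: eq_Rintegral => s _; rewrite mulrBr.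
Qed.

Lemma kernel_integral_le f : Linfty_L2 tau f ->
  `|\int[leb]_(s in I) (k s * L2inner (f s) phi)| <= Linfty_norm tau f / L.
Proof.
move=> [smf foo].
have [F [mF Ff]] := L2inner_ae_measurable smf.
have FM : {ae leb, forall s, I s -> `|F s| <= Linfty_norm tau f}.
  by apply: aeS2 Ff (L2inner_ae_bound foo) => s e h Is; rewrite -e// h.
have [_] := kernel_bounded mF (Linfty_norm_ge0 f) FM.
congr (`|_| <= _); congr fine; apply: ae_eq_integral_any.
by apply: aeS Ff => s e Is; rewrite e.
Qed.

End kernel_integrals.
End time_integrals.

(** * The truncation estimate *)

(** Young's inequality. A small [eta] keeps the coefficient of the noise close to 1, and [eta] = 1
    gives the usual factor 2. *)
Lemma sqrrD_le (R : realFieldType) (eta a b : R) : 0 < eta ->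
  (a + b) ^+ 2 <= (1 + eta) * a ^+ 2 + (1 + eta^-1) * b ^+ 2.
Proof.
move=> eta0; rewrite -subr_ge0.
have -> : (1 + eta) * a ^+ 2 + (1 + eta^-1) * b ^+ 2 - (a + b) ^+ 2 = (eta * a - b) ^+ 2 / eta.
  by field; rewrite gt_eqF.
by rewrite divr_ge0 ?sqr_ge0// ltW.
Qed.

Lemma sum_cut_le (R : realDomainType) (h : nat -> R) (N M : nat) : (forall n, 0 <= h n) ->
  \sum_(n < M) (if (n < N)%N then h n else 0) <= \sum_(n < N) h n.
Proof.
move=> h0; pose f n := if (n < N)%N then h n else 0.
have f0 n : 0 <= f n by rewrite /f; case: ifP.
rewrite -(big_mkord xpredT f) -(big_mkord xpredT h).
apply: (@le_trans _ _ (\sum_(0 <= n < N + M) f n)).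
  rewrite [leRHS](@big_cat_nat _ _ _ M)//= ?leq_addl// lerDl.
  by apply: sumr_ge0 => n _.
rewrite (@big_cat_nat _ _ _ N)//= ?leq_addr// [X in _ + X]big_nat_cond.
rewrite [X in _ + X]big1 ?addr0; last first.
  by move=> n /andP[/andP[Nn _] _]; rewrite /f ltnNge Nn.
by apply: ler_sum_nat => n /andP[_ nN]; rewrite /f nN.
Qed.

Section truncation_error.
Context {R : realType}.
Variables (mu p cl cu : R).
Hypotheses (mu2 : 2 < mu ^+ 2) (p0 : 0 < p) (cl0 : 0 < cl) (cu0 : 0 < cu).

(** This choice halves the gap: 2 (1 + eta) = mu^2 - (mu^2 - 2) / 2. What remains determines [K],
    the constant bounding the last retained eigenvalue. *)
Let eta : R := (mu ^+ 2 - 2) / 4.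
Let K : R := 2 * (1 + eta^-1) * cu ^+ 2 / (mu ^+ 2 - 2).

(** The first summand bounds the amplified noise on the retained modes; the other two bound the
    discarded modes of g, by the source condition and by the residual respectively. *)
Definition truncation_constant : R :=
  2 * K `^ (2 / (p + 2)) / cl ^+ 2 + 1 + (4 + 2 * mu ^+ 2) / cl ^+ 2.

Let eta0 : 0 < eta. Proof. by rewrite divr_gt0// subr_gt0. Qed.
Let p2 : 0 < p + 2. Proof. by rewrite addr_gt0. Qed.
Let K0 : 0 <= K.
Proof.
rewrite divr_ge0 ?subr_ge0 ?(ltW mu2)// mulr_ge0 ?sqr_ge0// mulr_ge0// addr_ge0//.
by rewrite invr_ge0 ltW.
Qed.

Lemma truncation_constant_gt0 : 0 < truncation_constant.
Proof.
rewrite /truncation_constant -addrA ltr_wpDl//.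
  by rewrite divr_ge0 ?sqr_ge0 ?mulr_ge0 ?powR_ge0.
by rewrite ltr_wpDr// divr_ge0 ?sqr_ge0// addr_ge0// mulr_ge0// sqr_ge0.
Qed.

(* N is the 0-based index of the last retained mode: N_delta is N.+1. *)
Variables (lam E g U V : nat -> R) (N : nat) (delta rho : R).
Hypotheses (lam0 : forall n, 0 < lam n) (lamS : forall n, lam n <= lam n.+1).
Hypotheses (Elb : forall n, cl <= E n * lam n ^+ 2) (Eub : forall n, E n * lam n ^+ 2 <= cu).
Hypotheses (UE : forall n, U n = E n * g n) (delta0 : 0 < delta) (rho0 : 0 < rho).
Hypothesis noise : forall M, \sum_(n < M) (U n - V n) ^+ 2 <= 2 * delta ^+ 2.
Hypothesis source : forall M, \sum_(n < M) lam n `^ (2 * p) * g n ^+ 2 <= rho ^+ 2.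
Hypothesis upper : forall M, \sum_(n < M) (if (n < N.+1)%N then 0 else V n) ^+ 2 <= (mu *
    delta) ^+ 2.
(** A lower bound on the infinite sum of squares beyond the modes n < N, phrased through upper
    bounds of its partial sums so that only finite sums occur. *)
Hypothesis lower : forall B, (forall M, \sum_(n < M) (if (n < N)%N then 0 else V n) ^+ 2 <= B) ->
  (mu * delta) ^+ 2 <= B.

(** The square of the convergence rate to be proved. *)
Let W : R := rho `^ (4 / (p + 2)) * delta `^ (2 * p / (p + 2)).

Let lam_mono m n : (m <= n)%N -> lam m <= lam n.
Proof. by move=> mn; have /nondecreasing_seqP h := lamS; exact: h. Qed.

Let E0 n : 0 < E n.
Proof. by have := lt_le_trans cl0 (Elb n); rewrite pmulr_lgt0// exprn_gt0. Qed.

Let Eup n : E n <= cu * (lam n ^+ 2)^-1.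
Proof. by rewrite ler_pdivlMr ?exprn_gt0. Qed.

Let Einv n : (E n)^-1 <= lam n ^+ 2 / cl.
Proof.
rewrite -[leRHS]invf_div lef_pV2 ?posrE ?divr_gt0 ?exprn_gt0//.
by rewrite ler_pdivrMr ?exprn_gt0.
Qed.

Let powR_2p n : lam n `^ (2 * p) * lam n ^+ 4 = lam n `^ (2 * (p + 2)).
Proof.
rewrite -(powR_mulrn 4 (ltW (lam0 n))) -powRD; last by rewrite (gt_eqF (lam0 n)) implybT.
by congr (_ `^ _); ring.
Qed.

Let U_tail n : (N <= n)%N ->
  U n ^+ 2 <= cu ^+ 2 / lam N `^ (2 * (p + 2)) * (lam n `^ (2 * p) * g n ^+ 2).
Proof.
move=> Nn; rewrite UE exprMn; have En := Eup n.
have h1 : E n ^+ 2 <= cu ^+ 2 * (lam n ^+ 4)^-1.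
  have -> : cu ^+ 2 * (lam n ^+ 4)^-1 = (cu * (lam n ^+ 2)^-1) ^+ 2 by field; rewrite gt_eqF.
  by rewrite ler_sqr ?nnegrE ?(ltW (E0 n))// mulr_ge0 ?invr_ge0 ?exprn_ge0 ?(ltW (lam0 n))
      ?(ltW cu0).
rewrite mulrA ler_wpM2r ?sqr_ge0//; apply: le_trans h1 _.
rewrite -mulrA ler_wpM2l ?sqr_ge0//.
have l4 : 0 < lam n ^+ 4 by rewrite exprn_gt0.
rewrite -(ler_pM2r l4) mulVf ?gt_eqF// -mulrA powR_2p mulrC ler_pdivlMr ?powR_gt0// mul1r.
apply: ge0_ler_powR; rewrite ?nnegrE ?(ltW (lam0 _))//; last exact: lam_mono.
by rewrite mulr_ge0// ltW.
Qed.

(** For n >= N, V is split into the noise and U. The noise contributes at most 2 (1 + eta) delta^2,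
    which [lower] exceeds by (mu^2 - 2) / 2 times delta^2; so U must carry the difference, while
    [U_tail] makes it small when lam N is large. *)
Let lam_N_le : lam N `^ (2 * (p + 2)) <= K * (rho / delta) ^+ 2.
Proof.
set B := (1 + eta) * (2 * delta ^+ 2) +
   (1 + eta^-1) * (cu ^+ 2 / lam N `^ (2 * (p + 2)) * rho ^+ 2).
have lN : 0 < lam N `^ (2 * (p + 2)) by rewrite powR_gt0.
have ei : 0 < eta^-1 by rewrite invr_gt0.
have : (mu * delta) ^+ 2 <= B.
  apply: lower => M.
  apply: (@le_trans _ _ (\sum_(n < M) ((1 + eta) * (U n - V n) ^+ 2 +
      (1 + eta^-1) * (cu ^+ 2 / lam N `^ (2 * (p + 2)) * (lam n `^ (2 * p) * g n ^+ 2))))).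
    apply: ler_sum => n _; case: ltnP => Nn.
      rewrite expr0n/= addr_ge0// mulr_ge0 ?sqr_ge0 ?addr_ge0 ?(ltW eta0) ?(ltW ei)//.
      by rewrite mulr_ge0 ?divr_ge0 ?sqr_ge0 ?powR_ge0// mulr_ge0 ?sqr_ge0 ?powR_ge0.
    have := sqrrD_le (- (U n - V n)) (U n) eta0.
    rewrite sqrrN [- _ + _](_ : _ = V n); last by ring.
    move=> /le_trans; apply; rewrite lerD2l ler_wpM2l ?addr_ge0 ?(ltW ei)//.
    exact: U_tail.
  rewrite big_split/= -!mulr_sumr; apply: lerD.
    by rewrite ler_wpM2l ?noise// addr_ge0// ltW.
  by rewrite ler_wpM2l ?addr_ge0 ?(ltW ei)// ler_wpM2l ?source// divr_ge0 ?sqr_ge0// ltW.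
move=> h; have m2 : 0 < mu ^+ 2 - 2 by rewrite subr_gt0.
have d2 : 0 < delta ^+ 2 by rewrite exprn_gt0.
have e1 : (mu ^+ 2 - 2) / 2 * delta ^+ 2 <= (1 + eta^-1) * (cu ^+ 2 / lam N `^ (2 * (p + 2)) *
    rho ^+ 2).
  rewrite -(lerD2l ((1 + eta) * (2 * delta ^+ 2))); apply: le_trans h.
  by rewrite le_eqVlt /eta; apply/orP; left; apply/eqP; field.
rewrite -(ler_pM2r (mulr_gt0 (divr_gt0 m2 (@ltr0n R 2)) d2)).
rewrite [leRHS](_ : _ = (1 + eta^-1) * cu ^+ 2 * rho ^+ 2);
    last by rewrite /K; field; rewrite !gt_eqF.
have := ler_wpM2l (ltW lN) e1; move/le_trans; apply.
by rewrite le_eqVlt; apply/orP; left; apply/eqP; field; rewrite !gt_eqF.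
Qed.

Let WE1 : delta ^+ 2 * ((rho / delta) ^+ 2) `^ (2 / (p + 2)) = W.
Proof.
have r0 := ltW rho0; have d0 := ltW delta0.
rewrite -!powR_mulrn ?divr_ge0// -powRrM powR_div//.
have -> : delta `^ 2 = delta `^ (2 * p / (p + 2)) * delta `^ (2 * (2 / (p + 2))).
  rewrite -powRD; last by rewrite (gt_eqF delta0) implybT.
  by congr (_ `^ _); field; rewrite gt_eqF.
have -> : 2 * (2 / (p + 2)) = 4 / (p + 2) by field; rewrite gt_eqF.
by rewrite /W; field; rewrite gt_eqF// powR_gt0.
Qed.

Let head_le : \sum_(n < N.+1) (g n - V n / E n) ^+ 2 <= 2 * K `^ (2 / (p + 2)) / cl ^+ 2 * W.
Proof.
have lN4 : lam N ^+ 4 <= K `^ (2 / (p + 2)) * ((rho / delta) ^+ 2) `^ (2 / (p + 2)).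
  rewrite -powRM ?sqr_ge0//.
  have -> : lam N ^+ 4 = (lam N `^ (2 * (p + 2))) `^ (2 / (p + 2)).
    by rewrite -powRrM -powR_mulrn ?(ltW (lam0 N))//; congr (_ `^ _); field; rewrite gt_eqF.
  apply: ge0_ler_powR lam_N_le; rewrite ?nnegrE ?powR_ge0 ?divr_ge0 ?(ltW p2)//.
  by rewrite mulr_ge0 ?sqr_ge0.
apply: (@le_trans _ _ (\sum_(n < N.+1) (U n - V n) ^+ 2 * (lam N ^+ 4 / cl ^+ 2))).
  apply: ler_sum => n _.
  have -> : g n - V n / E n = (U n - V n) / E n by rewrite UE; field; rewrite gt_eqF.
  rewrite exprMn ler_wpM2l ?sqr_ge0//.
  have -> : lam N ^+ 4 / cl ^+ 2 = (lam N ^+ 2 / cl) ^+ 2 by field; rewrite gt_eqF.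
  rewrite ler_sqr ?nnegrE ?invr_ge0 ?(ltW (E0 n)) ?divr_ge0 ?sqr_ge0 ?(ltW cl0)//.
  apply: le_trans (Einv n) _; rewrite ler_pM2r ?invr_gt0// ler_sqr ?nnegrE ?(ltW (lam0 _))//.
  by apply: lam_mono; rewrite -ltnS.
rewrite -mulr_suml; apply: (@le_trans _ _ (2 * delta ^+ 2 * (lam N ^+ 4 / cl ^+ 2))).
  by rewrite ler_wpM2r ?noise// divr_ge0 ?exprn_ge0 ?(ltW (lam0 N)) ?(ltW cl0).
have c0 : 0 <= 2 * delta ^+ 2 / cl ^+ 2 by rewrite divr_ge0 ?sqr_ge0// mulr_ge0 ?sqr_ge0.
have := ler_wpM2l c0 lN4; rewrite -WE1.
by congr (_ <= _); field; rewrite !gt_eqF.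
Qed.

Let tail_le M : \sum_(n < M) (if (n < N.+1)%N then 0 else g n) ^+ 2 <=
  (1 + (4 + 2 * mu ^+ 2) / cl ^+ 2) * W.
Proof.
(* Splitting the modes at lam n = r replaces the interpolation inequality. *)
pose r := (rho / delta) `^ (p + 2)^-1.
have rd : 0 < rho / delta by rewrite divr_gt0.
have r0 : 0 < r by rewrite powR_gt0.
have r2p : 0 < r `^ (2 * p) by rewrite powR_gt0.
(* The choice of r balances the two contributions: rho^2 r^(-2p) and r^4 delta^2 coincide, and both
   equal W. *)
have e1 : rho ^+ 2 / r `^ (2 * p) = W.
  rewrite /r -powRrM powR_div ?(ltW rho0)// -(powR_mulrn 2 (ltW rho0)).
  have -> : rho `^ 2 = rho `^ (4 / (p + 2)) * rho `^ ((p + 2)^-1 * (2 * p)).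
    rewrite -powRD; last by rewrite (gt_eqF rho0) implybT.
    by congr (_ `^ _); field; rewrite gt_eqF.
  rewrite /W; have -> : 2 * p / (p + 2) = (p + 2)^-1 * (2 * p) by ring.
  by field; rewrite !gt_eqF// powR_gt0.
have e2 : r ^+ 4 * delta ^+ 2 = W.
  rewrite -WE1 mulrC; congr (_ * _).
  rewrite -powR_mulrn ?(ltW r0)// /r -powRrM -powR_mulrn ?(ltW rd)// -powRrM.
  by congr (_ `^ _); field; rewrite gt_eqF.
have c2 : 0 < cl ^+ 2 by rewrite exprn_gt0.
apply: (@le_trans _ _ (\sum_(n < M) ((r `^ (2 * p))^-1 * (lam n `^ (2 * p) * g n ^+ 2) +
   r ^+ 4 / cl ^+ 2 * (2 * (U n - V n) ^+ 2 + 2 * (if (n < N.+1)%N then 0 else V n) ^+ 2)))).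
  apply: ler_sum => n _.
  have t1 : 0 <= (r `^ (2 * p))^-1 * (lam n `^ (2 * p) * g n ^+ 2).
    by rewrite mulr_ge0 ?invr_ge0 ?(ltW r2p)// mulr_ge0 ?powR_ge0 ?sqr_ge0.
  have t2 : 0 <= r ^+ 4 / cl ^+ 2 by rewrite divr_ge0 ?sqr_ge0// exprn_ge0// ltW.
  case: ifPn => nN.
    by rewrite expr0n/= mulr0 addr0 addr_ge0// mulr_ge0// mulr_ge0// sqr_ge0.
  (* A discarded mode with lam n >= r is paid for by the source condition. For lam n < r, g is
     recovered as U / E with 1 / E <= r^2 / cl, and U is split into the noise and the residual V. *)
  have [rl|lr] := leP r (lam n).
    rewrite -[leLHS]addr0 lerD//; last by rewrite mulr_ge0// addr_ge0// mulr_ge0// sqr_ge0.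
    rewrite mulrA ler_peMl ?sqr_ge0// mulrC ler_pdivlMr// mul1r.
    by apply: ge0_ler_powR => //; rewrite ?nnegrE ?(ltW r0) ?(ltW (lam0 n))// mulr_ge0// ltW.
  rewrite -[leLHS]add0r lerD//.
  have UV : U n ^+ 2 <= 2 * (U n - V n) ^+ 2 + 2 * V n ^+ 2.
    have := sqrrD_le (U n - V n) (V n) (@ltr01 R); rewrite subrK invr1; lra.
  apply: le_trans (ler_wpM2l t2 UV).
  have h1 : cl ^+ 2 <= E n ^+ 2 * lam n ^+ 4.
    have -> : E n ^+ 2 * lam n ^+ 4 = (E n * lam n ^+ 2) ^+ 2 by ring.
    by rewrite ler_sqr ?nnegrE ?(ltW cl0)// mulr_ge0 ?sqr_ge0 ?(ltW (E0 n)).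
  have h2 : lam n ^+ 4 <= r ^+ 4 by rewrite lerXn2r ?nnegrE ?(ltW r0) ?(ltW (lam0 n))// ltW.
  have h3 := le_trans h1 (ler_wpM2l (sqr_ge0 (E n)) h2).
  rewrite UE exprMn mulrA ler_peMl ?sqr_ge0// mulrAC ler_pdivlMr// mul1r mulrC.
  exact: h3.
rewrite big_split/= -!mulr_sumr big_split/= -!mulr_sumr.
apply: (@le_trans _ _ ((r `^ (2 * p))^-1 * rho ^+ 2 +
  r ^+ 4 / cl ^+ 2 * (2 * (2 * delta ^+ 2) + 2 * (mu * delta) ^+ 2))).
  apply: lerD; first by rewrite ler_wpM2l ?source// invr_ge0 ltW.
  rewrite ler_wpM2l ?divr_ge0 ?sqr_ge0 ?exprn_ge0 ?(ltW r0)//.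
  by apply: lerD; rewrite ler_wpM2l ?noise ?upper.
rewrite mulrC e1 le_eqVlt; apply/orP; left; apply/eqP.
by rewrite [RHS]mulrDl mul1r; congr (_ + _); rewrite -e2; field; rewrite gt_eqF.
Qed.

Lemma truncation_error_le M :
  \sum_(n < M) (g n - (if (n < N.+1)%N then V n / E n else 0)) ^+ 2 <= truncation_constant * W.
Proof.
apply: (@le_trans _ _ (\sum_(n < N.+1) (g n - V n / E n) ^+ 2 +
   \sum_(n < M) (if (n < N.+1)%N then 0 else g n) ^+ 2)).
  pose h n := (g n - V n / E n) ^+ 2.
  apply: (@le_trans _ _ (\sum_(n < M) ((if (n < N.+1)%N then h n else 0) + (if (n < N.+1)%N
      then 0 else g n) ^+ 2))).
    apply: ler_sum => n _; case: ifPn => _; first by rewrite expr0n addr0.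
    by rewrite subr0 add0r.
  by rewrite big_split/= lerD2r; apply: (sum_cut_le (h := h)) => n; exact: sqr_ge0.
apply: le_trans (lerD head_le (tail_le M)) _.
by rewrite le_eqVlt; apply/orP; left; apply/eqP; rewrite /truncation_constant; ring.
Qed.

End truncation_error.

(** * Convergence of the series defining theta *)

Section eigenvalue_sum.
Context {R : realType}.
Implicit Types (s : R) (n N : nat).

(** A discrete integral test. With y = n + 2, the tangent bound at (y - 1) / y gives ((y - 1) / y)^s
    <= 1 - s / y, and (1 + s / y)(1 - s / y) <= 1. *)
Lemma powR_telescope s n : 0 < s <= 1 ->
  s * n.+2%:R `^ (- (1 + s)) <= n.+1%:R `^ (- s) - n.+2%:R `^ (- s).
Proof.
move=> /andP[s0 s1]; have s01 : 0 <= s <= 1 by rewrite ltW.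
set x := n.+1%:R : R; set y := n.+2%:R : R.
have x0 : 0 < x by rewrite ltr0n.
have y0 : 0 < y by rewrite ltr0n.
have xy : x = y - 1 by rewrite /y -[n.+2%:R]natr1 addrK.
have h := powR_le_tangent (divr_gt0 x0 y0) s01.
have -> : y `^ (- (1 + s)) = y `^ (- s) / y.
  rewrite -[X in _ / X]powRr1 ?(ltW y0)// -powRN -powRD ?(gt_eqF y0) ?implybT//.
  by congr (_ `^ _); ring.
rewrite powR_div ?(ltW x0)// in h.
have xs0 : 0 < x `^ s by rewrite powR_gt0.
have ys0 : 0 < y `^ s by rewrite powR_gt0.
have e : 1 - s + s * (x / y) = 1 - s / y by rewrite xy; field; rewrite gt_eqF.
rewrite e in h; rewrite !powRN.
rewrite ler_pdivrMr// in h.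
have u0 : 0 < 1 - s / y by rewrite subr_gt0 ltr_pdivrMr// mul1r (le_lt_trans s1)// ltr1n.
have sy0 : 0 <= s / y by rewrite divr_ge0// ltW.
rewrite lerBrDr -(ler_pM2r xs0) mulVf ?gt_eqF//.
apply: (@le_trans _ _ ((s * ((y `^ s)^-1 / y) + (y `^ s)^-1) * ((1 - s / y) * y `^ s))).
  by rewrite ler_wpM2l// addr_ge0 ?mulr_ge0 ?invr_ge0 ?(ltW s0) ?(ltW ys0) ?(ltW y0).
have -> : (s * ((y `^ s)^-1 / y) + (y `^ s)^-1) * ((1 - s / y) * y `^ s) = 1 - (s / y) ^+ 2.
  by field; rewrite !gt_eqF.
by rewrite gerBl sqr_ge0.
Qed.

Lemma sum_powR_le s N : 0 < s <= 1 ->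
  \sum_(n < N) n.+1%:R `^ (- (1 + s)) <= 1 + s^-1.
Proof.
move=> s01; have /andP[s0 s1] := s01.
have si : 0 < s^-1 by rewrite invr_gt0.
case: N => [|N]; first by rewrite big_ord0 addr_ge0// ltW.
suff : \sum_(n < N.+1) n.+1%:R `^ (- (1 + s)) <= 1 + s^-1 * (1 - N.+1%:R `^ (- s)).
  move=> /le_trans; apply; rewrite lerD2l ler_piMr ?(ltW si)// gerBl powR_ge0//.
elim: N => [|N IH]; first by rewrite big_ord1 powR1 subrr mulr0 addr0.
rewrite big_ord_recr/=; apply: le_trans (lerD IH (_ : _ <= s^-1 * (N.+1%:R `^ (- s) - N.+2%:R
    `^ (- s)))) _.
  by rewrite -ler_pdivrMl ?invr_gt0// invrK powR_telescope.
by rewrite le_eqVlt; apply/orP; left; apply/eqP; ring.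
Qed.

(** Since d <= 7, lam_n^(-4) is of order at most n^(-8/7), which is where 7^(-1) comes from.
    Convergence is what gives the limit [theta] its meaning. *)
Lemma theta_ge (lam : nat -> R) (e1 : R) (d : nat) : (1 <= d <= 7)%N -> 0 < e1 ->
  (forall n, e1 * n.+1%:R `^ (2 / d%:R) <= lam n) ->
  forall N, \sum_(n < N) (lam n ^+ 4)^-1 <= theta lam.
Proof.
move=> /andP[d1 d7] e10 lamP N.
have d0 : 0 < d%:R :> R by rewrite ltr0n.
have e4 : 0 < (e1 ^+ 4)^-1 by rewrite invr_gt0 exprn_gt0.
have lam0 n : 0 < lam n by apply: lt_le_trans (lamP n); rewrite mulr_gt0// powR_gt0.
have le_s n : (lam n ^+ 4)^-1 <= (e1 ^+ 4)^-1 * n.+1%:R `^ (- (1 + 7^-1)).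
  apply: (@le_trans _ _ ((e1 ^+ 4)^-1 * n.+1%:R `^ (- (8 / d%:R)))).
    have -> : n.+1%:R `^ (- (8 / d%:R)) = ((n.+1%:R `^ (2 / d%:R)) ^+ 4)^-1 :> R.
      rewrite powRN -powR_mulrn ?powR_ge0// -powRrM; congr (_ `^ _)^-1; field.
      by rewrite gt_eqF.
    rewrite -invfM -exprMn lef_pV2 ?posrE ?exprn_gt0 ?mulr_gt0 ?powR_gt0//.
    by rewrite lerXn2r ?nnegrE ?(ltW (lam0 n))// mulr_ge0 ?powR_ge0// ltW.
  rewrite ler_pM2l//; apply: ler_powR; first by rewrite ler1n.
  rewrite lerN2; have -> : 1 + 7^-1 = 8 / 7 :> R by field.
  by rewrite ler_pM2l// lef_pV2 ?posrE// ler_nat.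
have f0 n : 0 <= (lam n ^+ 4)^-1 by rewrite invr_ge0 exprn_ge0// ltW.
rewrite -(big_mkord xpredT (fun n => (lam n ^+ 4)^-1)).
apply: (@nondecreasing_cvgn_le _ (series (fun n => (lam n ^+ 4)^-1))).
  by apply/nondecreasing_seqP => n; rewrite seriesSr lerDl.
apply: nondecreasing_is_cvgn.
  by apply/nondecreasing_seqP => n; rewrite seriesSr lerDl.
exists ((e1 ^+ 4)^-1 * (1 + (7^-1)^-1)) => _ [n _ <-]; rewrite /series/= big_mkord.
apply: (@le_trans _ _ (\sum_(i < n) (e1 ^+ 4)^-1 * i.+1%:R `^ (- (1 + 7^-1)))).
  by apply: ler_sum => i _; exact: le_s.
by rewrite -mulr_sumr ler_pM2l// sum_powR_le//; apply/andP; split; lra.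
Qed.

End eigenvalue_sum.

(** * Reduction of the inverse problem to sequences of coefficients *)

Section problem_estimates.
Context {R : realType} {d : nat} {Om : smooth_domain R d}.
Variables (alpha tau : R).
Hypotheses (alpha01 : 0 < alpha < 1) (tau0 : 0 < tau).

(** The constants are chosen before [lam], so that they depend only on alpha, tau and lam1. The
    additive 1 in the lower bound of E is absorbed by lam_n^2 / lam1^2 >= 1, and in the upper bound
    it is dropped. *)
Lemma symbol_bounds (lam1 : R) : 0 < lam1 -> exists cl cu : R, [/\ 0 < cl, 0 < cu &
  forall (lam : nat -> R) n, lam1 <= lam n ->
    cl <= symbol alpha tau lam n * lam n ^+ 2 <= cu].
Proof.
move=> l10; have /andP[a0 a1] := alpha01.
have t0 : 0 < tau `^ alpha by rewrite powR_gt0.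
have G0 : 0 < Gamma (1 - alpha) by rewrite Gamma_gt0 ?subr_gt0.
have H0 : 0 < Gamma (alpha + 1) by rewrite Gamma_gt0 ?addr_gt0.
pose cl := (tau `^ alpha * Gamma (1 - alpha) + (lam1 ^+ 2)^-1)^-1.
pose cu := Gamma (alpha + 1) / tau `^ alpha.
have cd : 0 < tau `^ alpha * Gamma (1 - alpha) + (lam1 ^+ 2)^-1.
  by rewrite addr_gt0 ?mulr_gt0// invr_gt0 exprn_gt0.
exists cl, cu; split; [by rewrite invr_gt0|by rewrite divr_gt0|].
move=> lam n l1; have l0 : 0 < lam n := lt_le_trans l10 l1.
have l2 : 0 < lam n ^+ 2 by rewrite exprn_gt0.
rewrite /symbol mulNr; set x := lam n ^+ 2 * tau `^ alpha.
have x0 : 0 < x by rewrite mulr_gt0.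
have E0 := mittag_leffler_a1_gt0 alpha01 (ltW x0).
have up := mittag_leffler_a1_upper alpha01 (ltW x0).
have lo := mittag_leffler_a1_lower alpha01 (ltW x0).
set E := mittag_leffler _ _ _ in E0 up lo *.
apply/andP; split.
  rewrite /cl -[leLHS]mul1r ler_pdivrMr//.
  have lo1 : 1 <= E * (x * Gamma (1 - alpha) + 1).
    have := ler_wpM2r (ltW G0) lo; rewrite mulVf ?gt_eqF// => /le_trans; apply.
    by rewrite le_eqVlt; apply/orP; left; apply/eqP; field; rewrite gt_eqF.
  apply: le_trans lo1 _.
  rewrite [leRHS](_ : _ = E * (x * Gamma (1 - alpha) + lam n ^+ 2 / lam1 ^+ 2));
      last by rewrite /x; ring.
  rewrite ler_pM2l// lerD2l.
  by rewrite ler_pdivlMr ?exprn_gt0// mul1r ler_sqr ?nnegrE ?(ltW l10) ?(ltW l0).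
have up1 : E * (x / Gamma (alpha + 1)) <= 1.
  by apply: le_trans up; rewrite ler_pM2l// lerDr.
by rewrite /cu ler_pdivlMr// -mulrA; rewrite mulrA ler_pdivrMr// mul1r in up1.
Qed.

Variables (lam : nat -> R) (phi : nat -> L2 Om).
Hypothesis lam0 : forall n, 0 < lam n.
Hypothesis onb : L2_orthonormal_basis phi.
Implicit Types (h g : L2 Om) (f : R -> L2 Om).

Lemma L2norm_basis n : L2norm (phi n) = 1.
Proof.
have [on _] := onb; apply/eqP; rewrite -(eqrXn2 (ltn0Sn 1)) ?L2norm_ge0//.
by rewrite L2norm_sqr on eqxx expr1n.
Qed.

Lemma Psi_le f n : Linfty_L2 tau f ->
  `|Psi alpha lam phi f n tau| <= Linfty_norm tau f / lam n ^+ 2.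
Proof.
move=> hf; have l2 : 0 < lam n ^+ 2 by rewrite exprn_gt0.
exact: (kernel_integral_le alpha01 tau0 (L2norm_basis n) l2 hf).
Qed.

Lemma Psi_diff f1 f2 n : Linfty_L2 tau f1 -> Linfty_L2 tau f2 ->
  `|Psi alpha lam phi f1 n tau - Psi alpha lam phi f2 n tau| <=
    Linfty_norm tau (fun s => f1 s - f2 s) / lam n ^+ 2.
Proof.
move=> h1 h2; have l2 : 0 < lam n ^+ 2 by rewrite exprn_gt0.
exact: (kernel_integral_diff alpha01 tau0 (L2norm_basis n) l2 h1 h2).
Qed.

Hypothesis thetaP : forall N, \sum_(n < N) (lam n ^+ 4)^-1 <= theta lam.

(** Shared by the square summability of Upsilon and by the noise bound. Its factor 2, from
    separating the two parts of c, is the origin of the condition mu > sqrt 2. *)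
Lemma sum_sqr_theta_le (c : nat -> R) (u : L2 Om) (b : nat -> R) (B : R) N :
  (forall n, c n = L2inner u (phi n) - b n) -> (forall n, `|b n| <= B / lam n ^+ 2) ->
  \sum_(n < N) c n ^+ 2 <= 2 * (L2norm u ^+ 2 + theta lam * B ^+ 2).
Proof.
move=> cE bB.
apply: (@le_trans _ _ (\sum_(n < N) (2 * L2inner u (phi n) ^+ 2 + 2 * (B ^+ 2 * (lam n ^+ 4)^-1)))).
  apply: ler_sum => n _; rewrite cE.
  have h1 := sqrrD_le (L2inner u (phi n)) (- b n) (@ltr01 R).
  have h2 : b n ^+ 2 <= B ^+ 2 * (lam n ^+ 4)^-1.
    have -> : B ^+ 2 * (lam n ^+ 4)^-1 = (B / lam n ^+ 2) ^+ 2 by field; rewrite gt_eqF.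
    by rewrite -real_normK ?num_real// ler_sqr ?nnegrE ?bB// (le_trans _ (bB n)).
  rewrite sqrrN invr1 in h1; lra.
rewrite big_split/= -!mulr_sumr -mulrDr ler_pM2l// lerD ?Bessel//.
by rewrite [leLHS]mulrC ler_wpM2r ?sqr_ge0 ?thetaP.
Qed.

Lemma Upsilon_coef_bounded h f : Linfty_L2 tau f -> exists B : R, forall N,
  \sum_(n < N) Upsilon_coef alpha tau lam phi h f n ^+ 2 <= B.
Proof.
move=> hf; exists (2 * (L2norm h ^+ 2 + theta lam * Linfty_norm tau f ^+ 2)) => N.
exact: (@sum_sqr_theta_le _ h (fun n => Psi alpha lam phi f n tau) _ _ (fun=> erefl) (fun n =>
    Psi_le n hf)).
Qed.

Lemma L2inner_Upsilon h f n : Linfty_L2 tau f ->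
  L2inner (Upsilon alpha tau lam phi h f) (phi n) = Upsilon_coef alpha tau lam phi h f n.
Proof. by move=> /(Upsilon_coef_bounded h)[B BP]; exact: (L2inner_series onb _ BP). Qed.

Lemma L2inner_forward_op g n :
  L2inner (forward_op alpha tau lam phi g) (phi n) = symbol alpha tau lam n * L2inner g (phi n).
Proof.
apply: (L2inner_series onb (c := fun n => symbol alpha tau lam n * L2inner g (phi n)) (B :=
    L2norm g ^+ 2)) => N.
apply: le_trans (Bessel onb g N); apply: ler_sum => i _.
rewrite exprMn ler_piMl ?sqr_ge0// /symbol mulNr.
have x0 : 0 <= lam i ^+ 2 * tau `^ alpha by rewrite mulr_ge0 ?sqr_ge0 ?powR_ge0.
by rewrite exprn_ile1 ?(ltW (mittag_leffler_a1_gt0 alpha01 x0)) ?mittag_leffler_a1_le1.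
Qed.

Lemma noise_le h1 h2 f1 f2 (delta : R) N : Linfty_L2 tau f1 -> Linfty_L2 tau f2 ->
  L2norm (h1 - h2) ^+ 2 + theta lam * Linfty_norm tau (fun s => f1 s - f2 s) ^+ 2 <= delta ^+ 2 ->
  \sum_(n < N) (Upsilon_coef alpha tau lam phi h1 f1 n -
                Upsilon_coef alpha tau lam phi h2 f2 n) ^+ 2 <= 2 * delta ^+ 2.
Proof.
move=> hf1 hf2 hd.
have e n : Upsilon_coef alpha tau lam phi h1 f1 n - Upsilon_coef alpha tau lam phi h2 f2 n =
    L2inner (h1 - h2) (phi n) -
    (Psi alpha lam phi f1 n tau - Psi alpha lam phi f2 n tau).
  by rewrite /Upsilon_coef L2innerBl; ring.
apply: le_trans (sum_sqr_theta_le N e (fun n => Psi_diff n hf1 hf2)) _.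
by rewrite ler_pM2l.
Qed.

Lemma L2inner_ae_eq (u v w : L2 Om) : u = v %[ae dom_measure Om] -> L2inner u w = L2inner v w.
Proof.
move=> uv; congr fine; apply: ae_eq_integral_any.
by apply: filterS uv => x e _; rewrite e.
Qed.

Lemma source_set_sum_le (p rho : R) g N : 0 < rho -> g \in source_set lam phi rho p ->
  \sum_(n < N) lam n `^ (2 * p) * L2inner g (phi n) ^+ 2 <= rho ^+ 2.
Proof.
move=> rho0; rewrite inE /source_set/= /Hp_norm.
set S := (\sum_(0 <= n <oo) _)%E => h.
have t0 n : (0 <= (lam n `^ (2 * p) * L2inner g (phi n) ^+ 2)%:E)%E.
  by rewrite lee_fin mulr_ge0 ?powR_ge0 ?sqr_ge0.
have S0 : (0 <= S)%E by apply: nneseries_ge0 => n _ _; exact: t0.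
have : (S <= (rho ^+ 2)%:E)%E.
  have -> : S = ((S `^ 2^-1) `^ 2)%E by rewrite -poweRrM mulVf ?poweRe1// pnatr_eq0.
  have -> : (rho ^+ 2)%:E = (rho%:E `^ 2)%E by rewrite poweR_EFin powR_mulrn// ltW.
  by apply: gt0_ler_poweR => //; rewrite in_itv/= ?poweR_ge0 ?leey// lee_fin ltW.
rewrite -lee_fin => hS; refine (le_trans _ hS); rewrite -sumEFin -(big_mkord xpredT (fun n =>
    (lam n `^ (2 * p) * L2inner g (phi n) ^+ 2)%:E)).
by apply: nneseries_lim_ge => n _ _; exact: t0.
Qed.

Lemma L2inner_discrepancy h f N n : Linfty_L2 tau f ->
  L2inner (Upsilon alpha tau lam phi h f - Upsilon_trunc alpha tau lam phi N h f) (phi n) =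
  if (n < N)%N then 0 else Upsilon_coef alpha tau lam phi h f n.
Proof.
move=> hf; rewrite L2innerBl L2inner_Upsilon// /Upsilon_trunc (L2inner_partial_sum onb).
by case: ifP => _; rewrite ?subrr ?subr0.
Qed.

End problem_estimates.

Theorem theorem5p7 (R : realType) (mu alpha tau lam1 e1 e2 p : R)
    (hmu : Num.sqrt 2 < mu) (halpha : 0 < alpha < 1) (htau : 0 < tau)
    (hlam1 : 0 < lam1) (he1 : 0 < e1) (he2 : 0 < e2) (hp : 0 < p) :
  exists2 C23 : R, 0 < C23 &
  forall (d : nat) (Om : smooth_domain R d) (lam : nat -> R) (phi : nat -> L2 Om),
  (1 <= d <= 7)%N ->
  dirichlet_eigensystem lam phi ->
  lam 0%N = lam1 ->
  (forall n : nat, e1 * n.+1%:R `^ (2 / d%:R) <= lam n <= e2 * n.+1%:R `^ (2 / d%:R)) ->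
  forall (delta : R) (h hdelta : L2 Om) (f fdelta : R -> L2 Om),
  0 < delta ->
  Linfty_L2 tau f -> Linfty_L2 tau fdelta ->
  L2norm (h - hdelta) ^+ 2 +
    theta lam * Linfty_norm tau (fun s => f s - fdelta s) ^+ 2 <= delta ^+ 2 ->
  forall Ndelta : nat,
  discrepancy alpha tau lam phi mu delta hdelta fdelta Ndelta ->
  (forall N : nat, discrepancy alpha tau lam phi mu delta hdelta fdelta N ->
    (Ndelta <= N)%N) ->
  forall (g : L2 Om) (rho : R),
  forward_op alpha tau lam phi g = Upsilon alpha tau lam phi h f
    %[ae dom_measure Om] ->
  0 < rho ->
  g \in source_set lam phi rho p ->
  L2norm (g - g_trunc alpha tau lam phi Ndelta hdelta fdelta) <=
    C23 * rho `^ (2 / (p + 2)) * delta `^ (p / (p + 2)).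
Proof.
have s20 : 0 <= Num.sqrt 2 :> R by apply: sqrtr_ge0.
have mu0 : 0 < mu := le_lt_trans s20 hmu.
have mu2 : 2 < mu ^+ 2.
  by rewrite -[ltLHS](@sqr_sqrtr R)// ltr_sqr ?nnegrE// ltW.
have [cl [cu [cl0 cu0 symbolP]]] := symbol_bounds halpha htau hlam1.
have C0 : 0 < truncation_constant mu p cl cu by exact: truncation_constant_gt0.
(* The coefficient estimate bounds the square of the error, hence the square root. *)
exists (Num.sqrt (truncation_constant mu p cl cu)); first by rewrite sqrtr_gt0.
move=> d Om lam phi d17 [lam0 _ lamS _ [onb _]] lam0E lamP delta h hd f fd delta0 hf hfd.
move=> noise N' [N0 upper lower] _ g rho fwd rho0 src.
case: N' N0 upper lower => [//|N] _ upper lower.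
have lam_ge n : lam1 <= lam n.
  by rewrite -lam0E; have /nondecreasing_seqP lam_nd := lamS; exact: lam_nd.
have lam_gt0 n : 0 < lam n := lt_le_trans hlam1 (lam_ge n).
have thetaP := theta_ge d17 he1 (fun n => proj1 (andP (lamP n))).
pose E := symbol alpha tau lam; pose g' n := L2inner g (phi n).
pose U := Upsilon_coef alpha tau lam phi h f; pose V := Upsilon_coef alpha tau lam phi hd fd.
(* The equation for g holds almost everywhere on Omega; pairing with an eigenfunction turns it into
   an exact relation between coefficients. *)
have UE n : U n = E n * g' n.
  rewrite -L2inner_forward_op// (L2inner_ae_eq _ fwd) L2inner_Upsilon//.
have muD : 0 <= mu * delta by rewrite mulr_ge0// ltW.
have up M : \sum_(n < M) (if (n < N.+1)%N then 0 else V n) ^+ 2 <= (mu * delta) ^+ 2.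
  have nb := upper; rewrite -ler_sqr ?nnegrE ?L2norm_ge0// in nb.
  apply: le_trans nb; apply: le_trans (Bessel onb _ M).
  rewrite le_eqVlt; apply/orP; left; apply/eqP; apply: eq_bigr => n _.
  by rewrite (L2inner_discrepancy halpha htau lam_gt0 onb thetaP).
(* Bessel's inequality sufficed for the upper bound, whereas the strict lower inequality of the
   discrepancy principle needs the full Parseval identity. *)
have lo B : (forall M, \sum_(n < M) (if (n < N)%N then 0 else V n) ^+ 2 <= B) ->
    (mu * delta) ^+ 2 <= B.
  move=> VB; have nb := ltW lower; rewrite -ler_sqr ?nnegrE ?L2norm_ge0// in nb.
  apply: le_trans nb _; apply: (Parseval_le onb) => M; apply: le_trans (VB M).
  rewrite le_eqVlt; apply/orP; left; apply/eqP; apply: eq_bigr => n _.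
  by rewrite (L2inner_discrepancy halpha htau lam_gt0 onb thetaP).
have noiseM M : \sum_(n < M) (U n - V n) ^+ 2 <= 2 * delta ^+ 2.
  exact: (noise_le halpha htau lam_gt0 onb thetaP).
have sourceM M := source_set_sum_le M rho0 src.
have El n : cl <= E n * lam n ^+ 2 by case/andP: (symbolP lam n (lam_ge n)).
have Eu n : E n * lam n ^+ 2 <= cu by case/andP: (symbolP lam n (lam_ge n)).
have main := truncation_error_le mu2 hp cl0 cu0 lam_gt0 lamS El Eu UE delta0 rho0
  noiseM sourceM up lo.
set rd := rho `^ _ * delta `^ _ in main.
have -> : Num.sqrt (truncation_constant mu p cl cu) * rho `^ (2 / (p + 2)) * delta `^ (p / (p +
    2)) =
    Num.sqrt (truncation_constant mu p cl cu * rd).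
  rewrite sqrtrM ?(ltW C0)// -mulrA; congr (_ * _).
  have p2 : p + 2 != 0 by rewrite gt_eqF// addr_gt0.
  have -> : rd = (rho `^ (2 / (p + 2)) * delta `^ (p / (p + 2))) ^+ 2.
    rewrite exprMn /rd -!powR_mulrn ?powR_ge0// -!powRrM.
    by congr (_ `^ _ * _ `^ _); field.
  by rewrite sqrtr_sqr ger0_norm// mulr_ge0 ?powR_ge0.
rewrite -[leLHS]ger0_norm ?L2norm_ge0// -sqrtr_sqr ler_wsqrtr//.
apply: (Parseval_le onb) => M; apply: le_trans (main M).
rewrite le_eqVlt; apply/orP; left; apply/eqP; apply: eq_bigr => n _.
rewrite L2innerBl /g_trunc (L2inner_partial_sum onb (fun n => V n / E n)).
by [].
Qed.
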